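(* Let $G$ be a graph. If $c_{1}(G-X)+c_{3}(G-X)+\frac{2}{3}c_{5}(G-X)+\frac{1}{3}c_{7}(G-X)\leq \frac{2}{3}|X|$ for all $X\subseteq V(G)$, then $G$ has a $\{P_{2},P_{9}\}$-factor.
   Context: All graphs are finite and simple. $P_n$ denotes the path with $n$ vertices. For a graph $H$ and $i\ge 1$, $c_i(H)$ denotes the number of (connected) components $C$ of $H$ with $|V(C)|=i$. $G-X$ is the graph obtained from $G$ by deleting the vertices in $X$. For a set $\mathcal{H}$ of connected graphs, an $\mathcal{H}$-factor of $G$ is a spanning subgraph $F$ of $G$ such that every component of $F$ is isomorphic to a graph in $\mathcal{H}$. *)

(* Defs.v *)
From mathcomp Require Import all_boot.

Set Implicit Arguments.
Unset Strict Implicit.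
Unset Printing Implicit Defensive.

Record sgraph := SGraph {
  vertex :> finType;
  adj : rel vertex;
  adj_sym : symmetric adj;
  adj_irrefl : irreflexive adj
}.

Definition isomorphic (G H : sgraph) : Prop :=
  exists2 f : G -> H, bijective f & forall x y, adj (f x) (f y) = adj x y.

Section Induced.
Variables (G : sgraph) (A : {set G}).

Definition induced_adj : rel {x : G | x \in A} := relpre val (@adj G).

Lemma induced_adj_sym : symmetric induced_adj.
Proof. by move=> x y; exact: adj_sym. Qed.

Lemma induced_adj_irrefl : irreflexive induced_adj.
Proof. by move=> x; exact: adj_irrefl. Qed.

Definition induced : sgraph := SGraph induced_adj_sym induced_adj_irrefl.
End Induced.

Definition delete (G : sgraph) (X : {set G}) : sgraph := induced (~: X).

(* Components are represented by their vertex sets. *)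
Definition components (G : sgraph) : {set {set G}} :=
  [set [set y | connect (@adj G) x y] | x : G].

Definition ncomp (i : nat) (G : sgraph) : nat :=
  #|[set C in components G | #|C| == i]|.

Section Path.
Variable n : nat.

Definition path_adj : rel 'I_n := fun i j => (i.+1 == j) || (j.+1 == i).

Lemma path_adj_sym : symmetric path_adj.
Proof. by move=> i j; rewrite /path_adj orbC. Qed.

Lemma path_adj_irrefl : irreflexive path_adj.
Proof. by move=> i; rewrite /path_adj orbb gtn_eqF. Qed.

Definition path_graph : sgraph := SGraph path_adj_sym path_adj_irrefl.
End Path.

(* A spanning subgraph of G is given by a symmetric subrelation F of adj on
   the same vertex type.  The family Hs matters only up to isomorphism. *)
Definition has_factor (Hs : sgraph -> Prop) (G : sgraph) : Prop :=
  exists (F : rel G) (Fsym : symmetric F) (Firr : irreflexive F),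
    subrel F (@adj G) /\
    forall C : {set G}, C \in components (SGraph Fsym Firr) ->
      exists2 H : sgraph, Hs H & isomorphic (@induced (SGraph Fsym Firr) C) H.

(* Main.v *)
(** Multiplied by 3, the hypothesis says that the components of [G - X] weigh at most
    [2|X|] in total, where orders 1, 3, 5, 7 have weights 3, 3, 2, 1.  A graph has a
    {P2,P9}-factor as soon as it has an odd path of order at least 9 whose complement
    is perfectly matched.

    A factor-critical graph [C] satisfying the hypothesis has such a path.  Otherwise
    look at the odd cycles [K] of [C] with [C - K] perfectly matched.  Length 7 or more
    yields a long path.  If the length is 5, the matched pairs outside [K] are joined
    only to [K], and two distinct outside vertices never see consecutive vertices of [K].  If all
    these cycles are triangles, some triangle has all other pairs attached directly to
    it, as pendant triangles.  In both cases, deleting two or three vertices of [K]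
    and one vertex of each pair violates the hypothesis.

    In general, a maximal barrier [S] leaves only factor-critical components, and can be
    matched into them.  Each component [D] without a factor contains a set [K D] with
    surplus at least [t D = 1] or [2] in the hypothesis, so that by Hall's theorem [D] can
    receive [t D] of the slots, two for each vertex of [S]; the matching of [S]
    makes it possible to use up all slots.  Contracting a vertex of [S] with the two
    components in its slots, again and again, leads to perfect matchings and to long odd
    paths between two components that were hit only once. *)
Require Import Defs.
From mathcomp Require Import all_boot all_order all_algebra.
From mathcomp Require Import zify lra.
From Stdlib Require Import Classical Btauto.
Import Order.TTheory GRing.Theory Num.Theory.

Set Implicit Arguments.
Unset Strict Implicit.
Unset Printing Implicit Defensive.

(** The numbers rest on 9 = 5 + 1 + 3. If the two slots of a barrier vertex [s] lie in different
    components, a long path can run through one of them, [s] and the other; its two pieces are odd,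
    and orders 5 and 3 suffice. A component with [t D < 2] offers a piece of order 5 from each
    vertex outside [K D], but perhaps only one of order 3 from a vertex of [K D]. A component with
    [t D = 2] may be a single vertex; it has to be hit twice, and is then matched outwards or passed
    through, whatever its order. Edges from the barrier to [D :\: K D] thus serve twice: they are
    the good entries, and deleting their ends in the barrier together with the sets [K D] isolates
    the heavy pieces that give Hall's condition. The obstacle is that Hall's theorem serves the
    components only, while every barrier vertex must be covered. Slots left empty are filled along
    the matching of the barrier, which may enter [K D]. The merge of the two injections has to keep
    every unit served and to avoid two poor entries, into different components, at one vertex. *)

Lemma adj_neq (G : sgraph) (x y : G) : adj x y -> x != y.
Proof. by apply: contraTneq => ->; rewrite adj_irrefl. Qed.

(** * Matchings and tilings by paths *)

Section Matching.
Variable G : sgraph.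
Implicit Types (A B : {set G}) (p : seq G) (m : G -> G).

Definition upath p := sorted (@adj G) p && uniq p.

(** The mate function is total and unconstrained outside [A], so that one [m] serves for [A] and for
    every union of its pairs. *)
Definition perf m A :=
  forall x, x \in A -> [/\ m x \in A, adj x (m x) & m (m x) = x].

Definition matchable A := exists m, perf m A.

Inductive tiled : {set G} -> Prop :=
  | Tiled0 : tiled set0
  | TiledU p A : upath p -> (size p == 2) || (size p == 9) ->
      [disjoint [set x in p] & A] -> tiled A -> tiled ([set x in p] :|: A).

Lemma perf_sub m A B :
  perf m A -> B \subset A -> (forall x, x \in B -> m x \in B) -> perf m B.
Proof.
move=> mA /subsetP sBA mB x xB; have [_ ? ?] := mA _ (sBA _ xB).
by split=> //; apply: mB.
Qed.

Lemma perf_inj m A x y : perf m A -> x \in A -> y \in A -> m x = m y -> x = y.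
Proof. by move=> mA /mA[_ _ {2}<-] /mA[_ _ {2}<-] ->. Qed.

Lemma perf_D2 m A x : perf m A -> x \in A -> perf m (A :\: [set x; m x]).
Proof.
move=> mA xA; have [mxA _ mmx] := mA x xA.
apply: (perf_sub mA); first exact: subsetDl.
move=> y; rewrite !inE !negb_or -andbA => /and3P[yx ymx yA].
have [myA _ mmy] := mA y yA; rewrite myA andbT; apply/andP; split.
  by apply: contraNneq ymx => <-; rewrite mmy.
by apply: contraNneq yx => /(perf_inj mA yA xA) ->.
Qed.

Lemma perf_card m A : perf m A -> ~~ odd #|A|.
Proof.
have [n] := ubnP #|A|; elim: n A => // n IHn A leAn mA.
have [->|[x xA]] := set_0Vmem A; first by rewrite cards0.
have [mxA /adj_neq xmx _] := mA x xA.
have sub2 : [set x; m x] \subset A by rewrite subUset !sub1set xA.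
have c2 : #|[set x; m x]| = 2 by rewrite cards2 xmx.
have := cardsD A [set x; m x]; rewrite (setIidPr sub2) c2 => cD.
have := subset_leq_card sub2; rewrite c2 => le2.
have := IHn _ _ (perf_D2 mA xA); rewrite cD => IH.
by rewrite -(subnK le2) oddD addbF IH //; lia.
Qed.

Lemma matchable0 : matchable set0.
Proof. by exists id => x; rewrite inE. Qed.

Lemma matchableU A B :
  [disjoint A & B] -> matchable A -> matchable B -> matchable (A :|: B).
Proof.
move=> dAB [m1 mA] [m2 mB]; exists (fun x => if x \in A then m1 x else m2 x).
move=> x; rewrite inE; case: ifPn => [xA _|xA /= xB].
  by have [m1A ? ?] := mA _ xA; rewrite inE m1A.
have [m2B ? ?] := mB _ xB; rewrite inE m2B orbT; split=> //.
rewrite ifN //; apply: contraTN m2B => ?; by rewrite (disjointFr dAB).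
Qed.

Lemma matchable2 x y : adj x y -> matchable [set x; y].
Proof.
move=> xy; exists (fun z => if z == x then y else x) => z.
have yx : y == x = false by apply/eqP => yx; rewrite yx adj_irrefl in xy.
rewrite !inE; case: eqP => [-> _|_ /= /eqP->].
  by rewrite yx eqxx orbT; split.
by rewrite !eqxx; split => //; rewrite adj_sym.
Qed.

Lemma tiled_U A B : [disjoint A & B] -> tiled A -> tiled B -> tiled (A :|: B).
Proof.
move=> dAB tA tB; elim: tA dAB => [|p A' up sp dpA tA IH] dAB.
  by rewrite set0U.
have /andP[dp dA] : [disjoint [set x in p] & B] && [disjoint A' & B].
  by move: dAB; rewrite !disjoints_subset subUset.
rewrite -setUA; apply: TiledU => //; last exact: IH.
by rewrite -setI_eq0 setIUr setU_eq0 !setI_eq0 dpA dp.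
Qed.

Lemma set2_seq (x y : G) : [set x; y] = [set z in [:: x; y]].
Proof. by apply/setP => z; rewrite !inE. Qed.

Lemma tiled2 x y : adj x y -> tiled [set x; y].
Proof.
move=> xy; rewrite -[X in tiled X]setU0 set2_seq; apply: TiledU => //.
- by rewrite /upath /= xy inE (adj_neq xy).
- by rewrite -setI_eq0 setI0.
- exact: Tiled0.
Qed.

Lemma matchable_tiled A : matchable A -> tiled A.
Proof.
case=> m; have [n] := ubnP #|A|; elim: n A => // n IHn A leAn mA.
have [->|[x xA]] := set_0Vmem A; first exact: Tiled0.
have [mxA xmx _] := mA x xA.
have sub2 : [set x; m x] \subset A by rewrite subUset !sub1set xA.
rewrite -(setID A [set x; m x]) (setIidPr sub2); apply: tiled_U.
- by rewrite disjoints_subset setCD subsetUr.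
- exact: tiled2.
- apply: IHn (perf_D2 mA xA); rewrite ltnS in leAn.
  apply: leq_trans leAn; apply: proper_card; rewrite properE subsetDl.
  by apply/subsetPn; exists x => //; rewrite !inE eqxx.
Qed.

Lemma upath_cons x p : upath (x :: p) = [&& path (@adj G) x p, x \notin p & uniq p].
Proof. by []. Qed.

Lemma upath_tl x p : upath (x :: p) -> upath p.
Proof. by case/and3P => /path_sorted sp _ up; rewrite /upath sp. Qed.

(** Peel off the first two vertices as a tile, again and again: an even path is used up, an odd one
    of order at least 9 is stopped at order exactly 9. *)
Lemma upath_tiled p : upath p -> ~~ odd (size p) || (9 <= size p) ->
  tiled [set x in p].
Proof.
have [n] := ubnP (size p); elim: n p => // n IHn p lepn up sp.
have [s9|s9] := eqVneq (size p) 9.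
  rewrite -[X in tiled X]setU0; apply: TiledU => //; rewrite ?s9 //.
    by rewrite -setI_eq0 setI0.
  exact: Tiled0.
case: p => [|x [|y p]] in lepn up sp s9 *.
- by rewrite set_nil; apply: Tiled0.
- by [].
rewrite (_ : [set _ in _] = [set x; y] :|: [set z in p]); last first.
  by apply/setP => z; rewrite !inE orbA.
have /and3P[/= /andP[xy pp] xp /andP[yp upp]] := up.
apply: tiled_U; last 1 first.
- apply: IHn; [by move: lepn => /=; lia| exact: upath_tl (upath_tl up)|].
  by move: sp s9; rewrite /= negbK; lia.
- rewrite disjoints_subset subUset !sub1set !inE yp andbT.
  by apply: contra xp; rewrite inE orbC => ->.
- exact: tiled2.
Qed.

Lemma tiled_path p A : upath p -> {subset p <= A} -> odd (size p) ->
  9 <= size p -> matchable (A :\: [set x in p]) -> tiled A.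
Proof.
move=> up sp op s9 mA; have spA : [set x in p] \subset A.
  by apply/subsetP => x; rewrite inE; apply: sp.
rewrite -(setID A [set x in p]) (setIidPr spA); apply: tiled_U.
- by rewrite disjoints_subset setCD subsetUr.
- by apply: upath_tiled => //; rewrite s9 orbT.
- exact: matchable_tiled.
Qed.

Lemma upath_rev p : upath (rev p) = upath p.
Proof.
rewrite /upath rev_uniq rev_sorted; congr (_ && _).
by apply: eq_sorted => x y; rewrite adj_sym.
Qed.

End Matching.

(** * Weights of components *)

(* Three times the coefficients of [c_1], [c_3], [c_5] and [c_7]. *)
Definition wt n := (3 * ((n == 1) || (n == 3)) + 2 * (n == 5) + (n == 7))%N.

Lemma wt_gt7 n : 7 < n -> wt n = 0.
Proof. by do 8?case: n => // n. Qed.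

(** The weight is 0 at even orders and does not increase along the odd ones, and an odd sum has an
    odd summand. Since orders above 7 weigh 0, a finite check does it. *)
Lemma wt_add m n : wt (m + n) <= wt m + wt n.
Proof.
case: (ltnP 7 m) => [lt7m|]; first by rewrite wt_gt7 // ltn_addr.
case: (ltnP 7 n) => [lt7n|]; first by rewrite wt_gt7 // ltn_addl.
by move: m n; do 8?case=> //; do 8?case=> //.
Qed.

Section Weight.
Variable G : sgraph.
Implicit Types (A B X : {set G}).

(** Components are formed in [G] itself, with adjacency cut down to [A], and not in the subtype
    [induced A]: subsets of different extent then stay comparable. *)
Definition adj_in A : rel G := [rel x y | [&& x \in A, y \in A & adj x y]].

Definition comps A : {set {set G}} :=
  equivalence_partition (connect (adj_in A)) A.

Definition weight A := \sum_(D in comps A) wt #|D|.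

Lemma adj_in_sym A : symmetric (adj_in A).
Proof. by move=> x y; rewrite /adj_in /= adj_sym andbCA. Qed.

Lemma comps_partition A : partition (comps A) A.
Proof.
apply: equivalence_partitionP => x y z _ _ _; split; first exact: connect0.
by move=> xy; apply: same_connect xy _; apply: sym_connect_sym (adj_in_sym A).
Qed.

(** Subadditivity bounds the weight from below by the cardinality alone, so that most estimates need
    no knowledge of how a set falls into components. *)
Lemma weight_ge_wt A : wt #|A| <= weight A.
Proof.
rewrite (card_partition (comps_partition A)) /weight.
elim/big_rec2: _ => // D n k _ le_kn.
by apply: leq_trans (wt_add _ _) _; rewrite leq_add2l.
Qed.

Lemma connect_adj_in A x y : x \in A -> connect (adj_in A) x y -> y \in A.
Proof.
move=> + /connectP[p]; elim: p x => [|z p IHp] x xA /=; first by move=> _ ->.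
by case/andP => /and3P[_ zA _] /(IHp _ zA).
Qed.

Lemma connect_adj_inU A B : (forall x y, x \in A -> y \in B -> ~~ adj x y) ->
  {in A, connect (adj_in (A :|: B)) =2 connect (adj_in A)}.
Proof.
move=> nAB x xA y; apply/idP/idP; last first.
  apply: connect_sub => {xA y}x y /and3P[xA yA xy].
  by apply: connect1; rewrite /adj_in /= !inE xA yA.
case/connectP => p; elim: p x xA => [|z p IHp] x xA /=; first by move=> _ ->.
rewrite {1}/adj_in /= !inE xA /=; case/andP => /andP[/orP zAB xz] pz yz.
case: zAB => [zA|zB]; last by rewrite (negPf (nAB _ _ xA zB)) in xz.
have := IHp z zA pz yz; apply: connect_trans; apply: connect1.
by rewrite /adj_in /= xA zA.
Qed.

Lemma comps_subU A B : (forall x y, x \in A -> y \in B -> ~~ adj x y) ->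
  comps A \subset comps (A :|: B).
Proof.
move=> nAB; apply/subsetP => D /imsetP[x xA ->]; apply/imsetP.
exists x; first by rewrite inE xA.
apply/setP => y; rewrite !inE connect_adj_inU //.
by apply: andb_id2r => /(connect_adj_in xA) ->.
Qed.

Lemma weightU A B : [disjoint A & B] ->
  (forall x y, x \in A -> y \in B -> ~~ adj x y) ->
  weight A + weight B <= weight (A :|: B).
Proof.
move=> dAB nAB; have nBA x y : x \in B -> y \in A -> ~~ adj x y.
  by move=> xB yA; rewrite adj_sym nAB.
have dC : [disjoint comps A & comps B].
  apply/pred0P => D /=; apply/negP => /andP[DA DB].
  have /and3P[/eqP cA _ n0] := comps_partition A.
  have /and3P[/eqP cB _ _] := comps_partition B.
  have /set0Pn[x xD] : D != set0 by apply: contraNneq n0 => <-.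
  have xA : x \in A by rewrite -cA; apply/bigcupP; exists D.
  have xB : x \in B by rewrite -cB; apply/bigcupP; exists D.
  by rewrite (disjointFr dAB xA) in xB.
have sBU : comps B \subset comps (A :|: B) by rewrite setUC comps_subU.
rewrite /weight [leqRHS](big_setID (comps A)) /= (setIidPr (comps_subU nAB)).
rewrite leq_add2l [leqRHS](big_setID (comps B)) /= (setIidPr _) ?leq_addr //.
by rewrite subsetD sBU disjoint_sym.
Qed.

(** The hypothesis bounds [ncomp] from above, so it is enough to lift each member of [comps] to a
    component of [delete X] of the same order. *)
Lemma ncomp_ge i X :
  #|[set D in comps (~: X) | #|D| == i]| <= ncomp i (delete X).
Proof.
set N := [set C in components (delete X) | #|C| == i].
apply: leq_trans (leq_imset_card (fun C : {set delete X} => val @: C) N).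
apply: subset_leq_card; apply/subsetP => D; rewrite inE => /andP[].
case/imsetP => x xX Dx Di; apply/imsetP.
pose x' : delete X := exist _ x xX; pose C := [set y | connect (@adj _) x' y].
have CP (v : delete X) : (v \in C) = connect (@adj _) x' v by rewrite inE.
have eqcon (u : delete X) p : path (adj_in (~: X)) (val u) p ->
    exists2 v : delete X, connect (@adj _) u v & val v = last (val u) p.
  elim: p u => [|z p IHp] u /=; first by exists u.
  case/andP => /and3P[_ zX uz] /(IHp (exist _ z zX))[v zv <-]; exists v => //.
  by apply: connect_trans (connect1 _) zv.
have DC : D = val @: C.
  rewrite Dx; apply/setP => y; apply/idP/imsetP.
    rewrite inE => /andP[yX /connectP[p pp ->]].
    by have [v xv <-] := eqcon x' p pp; exists v; rewrite // inE.
  case=> v vC ->; have xv := etrans (esym (CP v)) vC.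
  rewrite in_set; apply/andP; split; first by case: v {xv vC} => v /=; rewrite inE.
  have [p pp ->] := connectP xv; rewrite -[x]/(val x').
  elim: p (x') pp => [|z p IHp] u /=; first by rewrite connect0.
  case/andP => uz /IHp; apply: connect_trans; apply: connect1.
  by apply/and3P; split=> //; [by case: u {uz}|by case: z {uz}].
exists C => //; rewrite inE imset_f //=.
by rewrite -(card_imset _ val_inj) -DC.
Qed.

Lemma weight_ncomp X : weight (~: X) <=
  3 * ncomp 1 (delete X) + 3 * ncomp 3 (delete X) + 2 * ncomp 5 (delete X)
  + ncomp 7 (delete X).
Proof.
have S i : \sum_(D in comps (~: X)) (#|D| == i : nat) <= ncomp i (delete X).
  apply: leq_trans (ncomp_ge _ _); rewrite -sum1_card big_mkcond /=.
  rewrite [leqRHS](eq_bigl _ _ (fun D => in_set _ D)) [leqRHS]big_mkcond /=.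
  by apply: leq_sum => D _; case: (_ \in _) => //=; case: (_ == _).
apply: leq_trans (leq_add (leq_add (leq_add (leq_mul (leqnn 3) (S 1))
  (leq_mul (leqnn 3) (S 3))) (leq_mul (leqnn 2) (S 5))) (S 7)).
rewrite /weight !big_distrr -!big_split /=; apply: leq_sum => D _.
by rewrite /wt; case: eqP => [->|_] //=; lia.
Qed.

End Weight.

(** * Factor-critical graphs *)

Ltac set_bool := apply/setP => ?; rewrite !inE; first
  [ btauto
  | repeat match goal with
    | |- context [eq_op ?a ?b] => case: (eq_op a b) => //=
    | |- context [in_mem ?a ?b] => case: (in_mem a b) => //=
    end ].

Ltac neqs := rewrite ?inE ?negb_or;
  repeat match goal with
  | H : is_true (negb (in_mem _ (mem (cons _ _)))) |- _ => rewrite in_cons in H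
  | H : is_true (negb (in_mem _ (mem [::]))) |- _ => clear H
  | H : is_true (negb (_ || _)) |- _ => rewrite negb_or in H
  | H : is_true (_ && _) |- _ => case/andP: H => ? ?
  end;
  repeat match goal with
  | H : is_true (negb (eq_op ?x ?y)) |- _ =>
    rewrite ?(negPf H) ?[eq_op y x]eq_sym ?(negPf H); clear H
  | H : is_true (@adj _ ?x ?y) |- _ =>
    rewrite ?H ?(negPf (adj_neq H)) ?[eq_op y x]eq_sym ?(negPf (adj_neq H));
    clear H
  | H : is_true (negb _) |- _ => rewrite ?(negPf H); clear H
  end; rewrite /= ?andbT //.

Section FactorCritical.
Variable G : sgraph.
Implicit Types (A B C D : {set G}) (p : seq G) (m : G -> G).

Definition fcrit C := forall v, v \in C -> matchable (C :\ v).

(* The path lies in the symmetric difference of the two matchings; that it ends with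
   the [m1]-edge at [y] matters in [mate_adj] below. *)
Lemma alternating_path m1 m2 A x y : x \in A -> y \in A -> x != y ->
  perf m1 (A :\ x) -> perf m2 (A :\ y) ->
  exists p, let q := x :: rcons (rcons p (m1 y)) y in
    [/\ upath q, {subset q <= A}, ~~ odd (size p)
      & perf m1 (A :\: [set z in q])].
Proof.
have [n] := ubnP #|A|; elim: n A x => // n IHn A x leAn xA yA xy pm1 pm2.
have [|m2xA xx1 m2m2] := pm2 x; first by rewrite !inE xy.
move: m2xA xx1 m2m2; set x1 := m2 x; rewrite !inE => /andP[x1y x1A] xx1 m2x1.
have x1x : x1 != x by rewrite eq_sym; apply: adj_neq.
have x1A' : x1 \in A :\ x by rewrite !inE x1x.
have [] := pm1 _ x1A'.
set x2 := m1 x1; rewrite !inE => /andP[x2x x2A] x1x2 m1x2.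
have x2x1 : x2 != x1 by rewrite eq_sym; apply: adj_neq.
have pm1' := perf_D2 pm1 x1A'.
have [eqx2y|x2y] := eqVneq x2 y.
  exists [::]; rewrite -eqx2y m1x2 /=; split=> //.
  - by rewrite /upath /= xx1 x1x2 !inE negb_or (adj_neq xx1) (adj_neq x1x2) eq_sym x2x.
  - by apply/allP; rewrite /= xA x1A x2A.
  - by move: pm1'; rewrite -/x2; congr perf; set_bool.
(* From [x], missed by [m1], the walk has taken the [m2]-edge to [x1] and the [m1]-edge to [x2].
   Within [A'] it is [x2] that [m1] misses, while [m2] still misses [y]: the induction goes on from
   [x2]. *)
pose A' := A :\: [set x; x1].
have x2A' : x2 \in A' by rewrite !inE negb_or x2x x2x1.
have yA' : y \in A' by rewrite !inE negb_or yA ![y == _]eq_sym xy x1y.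
have ltA' : #|A'| < n.
  rewrite -ltnS; apply: leq_trans leAn; rewrite ltnS; apply: proper_card.
  rewrite properE subsetDl; apply/subsetPn; exists x => //.
  by rewrite !inE eqxx.
have pA1 : perf m1 (A' :\ x2).
  by rewrite (_ : _ :\ x2 = A :\ x :\: [set x1; m1 x1]) // -/x2 /A'; set_bool.
have pA2 : perf m2 (A' :\ y).
  rewrite (_ : _ :\ y = A :\ y :\: [set x; m2 x]); last by rewrite /A' -/x1; set_bool.
  by apply: perf_D2 => //; rewrite !inE xy.
have [p /= [up sp op pp]] := IHn A' x2 ltA' x2A' yA' x2y pA1 pA2.
move: up sp pp; set q := rcons _ _ => up sp pp.
have notq z : z \in [set x; x1] -> z \notin x2 :: q.
  by move=> zx; apply/negP => /sp; rewrite in_setD zx.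
exists (x1 :: x2 :: p); rewrite /= -/q; split.
- rewrite upath_cons /= xx1 x1x2 /=; have := up; rewrite upath_cons => /and3P[-> -> ->].
  have := notq x; have := notq x1; rewrite !inE !eqxx orbT !negb_or /=.
  by move=> /(_ isT)/andP[-> ->] /(_ isT)/andP[-> ->]; rewrite eq_sym x1x.
- move=> z; rewrite !inE => /or3P[/eqP->//|/eqP->//|zq].
  by have : z \in A' by [apply: sp; rewrite inE]; rewrite inE => /andP[].
- by rewrite negbK.
- by move: pp; congr perf; rewrite /A'; set_bool.
Qed.

(** Minimum degree two: the mate of [u] in a perfect matching of [C :\ a] is a neighbour other than
    [a]. *)
Lemma fcrit_deg2 C u a : fcrit C -> u \in C -> a \in C -> a != u ->
  exists2 b, b \in C & b != a /\ adj u b.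
Proof.
move=> fC uC aC au; have [m /(_ u)[]] := fC a aC; first by rewrite !inE eq_sym au.
by rewrite !inE => /andP[ba bC] ub _; exists (m u).
Qed.

Lemma fcrit_odd C : fcrit C -> C != set0 -> odd #|C|.
Proof.
move=> fC /set0Pn[x xC]; have [m /perf_card] := fC x xC.
by rewrite (cardsD1 x C) xC /= => ->.
Qed.

(** An alternating path inside [C] leads from [x] to [y], and it cannot leave a set closed under
    adjacency. The form is that of an induction principle along edges. *)
Lemma fcrit_connected C A x y : fcrit C -> x \in A -> x \in C -> y \in C ->
  (forall z t, z \in A -> t \in C -> adj z t -> t \in A) -> y \in A.
Proof.
move=> fC xA xC yC clA; have [<-//|xy] := eqVneq x y.
have [m1 pm1] := fC x xC; have [m2 pm2] := fC y yC.
have [p /= [/and3P[pp _ _] sp _ _]] := alternating_path xC yC xy pm1 pm2.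
have {sp}: {subset rcons (rcons p (m1 y)) y <= C}.
  by move=> z zp; apply: sp; rewrite inE zp orbT.
suff: last x (rcons (rcons p (m1 y)) y) \in A -> y \in A.
  move=> H sp; apply: H; elim: (rcons _ y) x xA {xC xy pm1} pp sp => //= z q IH x.
  move=> xA /andP[xz zq] sq; apply: IH => //.
    by apply: clA xz => //; apply: sq; rewrite inE eqxx.
  by move=> t tq; apply: sq; rewrite inE tq orbT.
by rewrite last_rcons.
Qed.

End FactorCritical.

(** * Surplus gained from matched pairs *)

Section Pairs.
Variable G : sgraph.
Implicit Types (A B C D R T X Y : {set G}) (p l : seq G) (m : G -> G).

Lemma set1_seq (x : G) : [set z in [:: x]] = [set x].
Proof. by apply/setP => z; rewrite !inE. Qed.

(** The pairs are isolated edges of [R]. Deleting one end of each costs 2 and leaves a single vertex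
    of weight 3, so each pair yields a surplus of 1. *)
Lemma pairs_split m R : perf m R ->
  (forall u z, u \in R -> z \in R -> adj u z -> z = m u) ->
  exists T, [/\ T \subset R, 2 * #|T| = #|R| & 3 * #|T| <= weight (R :\: T)].
Proof.
have [n] := ubnP #|R|; elim: n R => // n IHn R leRn pm adjR.
have [->|[u uR]] := set_0Vmem R; first by exists set0; rewrite sub0set !cards0.
have [mR /adj_neq umu mmu] := pm u uR.
have cR : #|R :\: [set u; m u]| + 2 = #|R|.
  have s2 : [set u; m u] \subset R by rewrite subUset !sub1set uR.
  have c2 : #|[set u; m u]| = 2 by rewrite cards2 umu.
  rewrite -c2 cardsD (setIidPr s2) c2 subnK //.
  by rewrite -c2; apply: subset_leq_card.
have [|u' z|T [sTR cT wT]] := IHn _ _ (perf_D2 pm uR).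
- by move: leRn; lia.
- by rewrite !in_setD => /andP[_ uR'] /andP[_ zR]; apply: adjR.
have muT : m u \notin T.
  by apply/negP => /(subsetP sTR); rewrite !inE eqxx orbT.
have uT : u \notin T by apply/negP => /(subsetP sTR); rewrite !inE eqxx.
exists (m u |: T); split.
- rewrite subUset sub1set mR; apply: subset_trans sTR _; exact: subsetDl.
- by rewrite cardsU1 muT; lia.
have eqR : R :\: (m u |: T) = [set u] :|: ((R :\: [set u; m u]) :\: T).
  apply/setP => z; rewrite !inE; have [->|zu] := eqVneq z u.
    by rewrite uR (negPf uT) (negPf umu).
  by rewrite !negb_or /= -!andbA; bool_congr; rewrite andbCA.
rewrite cardsU1 muT eqR mulnDr; apply: leq_trans (weightU _ _).
- apply: leq_add wT; apply: leq_trans (weight_ge_wt _); by rewrite cards1.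
- by rewrite disjoints_subset sub1set !inE eqxx /= andbF.
- move=> x y; rewrite inE => /eqP->; rewrite !inE negb_or -!andbA.
  case/and4P => _ _ ymu yR; apply: contra ymu => uy.
  by rewrite (adjR _ _ uR yR uy).
Qed.

(* [X] consists of [Y] and one vertex of each pair of [R]. *)
Lemma pairs_gain m B R Y g : [disjoint B & R] -> perf m R -> Y \subset B ->
  (forall u z, u \in R -> z \in B :|: R -> adj u z -> z \in Y \/ z = m u) ->
  4 * #|Y| + 2 * g <= 2 * weight (B :\: Y) + #|R| ->
  exists X, [/\ X \subset B :|: R, Y \subset X
              & 2 * #|X| + g <= weight ((B :|: R) :\: X)].
Proof.
move=> dBR pm sYB adjR le_g.
have dYR z : z \in R -> z \notin B by move=> zR; rewrite (disjointFl dBR zR).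
have [|T [sTR cT wT]] := pairs_split pm.
  move=> u z uR zR uz; have [] := adjR u z uR _ uz => //.
    by rewrite inE zR orbT.
  by move/(subsetP sYB); rewrite (negPf (dYR _ zR)).
exists (Y :|: T); split; first by rewrite setUSS.
  exact: subsetUl.
have cYT : #|Y :|: T| <= #|Y| + #|T| by rewrite cardsU leq_subr.
have eqD : (B :|: R) :\: (Y :|: T) = (B :\: Y) :|: (R :\: T).
  apply/setP => z; rewrite !inE negb_or.
  have [zR|zR] := boolP (z \in R).
    have zB := dYR _ zR; rewrite (negPf zB) !andbT andbF /=.
    by rewrite (negPf (contraNN (subsetP sYB z) zB)).
  by rewrite (negPf (contraNN (subsetP sTR z) zR)); case: (_ \in Y); case: (_ \in B).
(* Each pair adds 3 - 2 = 1 to the surplus and [#|R|] is twice the number of pairs, hence the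
   doubled form of [le_g]. *)
rewrite eqD; apply: leq_trans (weightU _ _); first by move: le_g wT; lia.
- rewrite disjoints_subset; apply/subsetP => z; rewrite !inE.
  by case/andP => _ zB; rewrite (disjointFr dBR zB) andbF.
move=> x y; rewrite !inE => /andP[xY xB] /andP[yT yR]; apply/negP => xy.
rewrite adj_sym in xy; have [] := adjR y x yR _ xy; rewrite ?inE ?xB //.
  by rewrite (negPf xY).
by move=> eqx; have [] := pm y yR; rewrite -eqx (disjointFr dBR xB).
Qed.

Lemma matchable_drop C x y l : adj x y -> x \in C -> y \in C ->
  x \notin l -> y \notin l ->
  matchable (C :\: [set z in x :: y :: l]) -> matchable (C :\: [set z in l]).
Proof.
move=> xy xC yC xl yl mC.
rewrite (_ : _ :\: _ = [set x; y] :|: (C :\: [set z in x :: y :: l])).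
  apply: matchableU (matchable2 xy) mC; rewrite disjoints_subset subUset.
  by rewrite !sub1set !inE !eqxx orbT.
apply/setP => z; rewrite !inE.
have [->|zx] := eqVneq z x; first by rewrite xl xC.
by have [->|zy] := eqVneq z y; first by rewrite yl yC.
Qed.

Lemma perf_pair m C u l : perf m (C :\: [set z in l]) -> u \in C -> u \notin l ->
  [/\ m u \in C, m u \notin l, m u != u & adj u (m u)]
  /\ perf m (C :\: [set z in m u :: u :: l]).
Proof.
move=> pm uC ul; have uD : u \in C :\: [set z in l] by rewrite !inE ul.
have [] := pm u uD; rewrite !inE => /andP[mul muC] umu _; split.
  by split=> //; rewrite eq_sym adj_neq.
by move: (perf_D2 pm uD); congr perf; set_bool.
Qed.

End Pairs.

(** * Saturated paths and windmills *)

Section Windmill.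
Variable G : sgraph.
Implicit Types (A B C D : {set G}) (p : seq G) (m : G -> G).

(** Such a path can be prolonged out of [D] at its first vertex [v], with the rest of [D] matched.
    The bound [n] counts vertices; only 3 and 5 will occur. *)
Definition sat D v n := exists p,
  [/\ upath (v :: p), {subset v :: p <= D}, odd (size (v :: p)),
      n <= size (v :: p) & matchable (D :\: [set z in v :: p])].

Lemma sat3 D v : fcrit D -> v \in D -> 1 < #|D| -> sat D v 3.
Proof.
move=> fD vD D1; have [a aD av] : exists2 a, a \in D & a != v.
  move: D1; rewrite (cardsD1 v) vD ltnS card_gt0 => /set0Pn[a].
  by rewrite !inE => /andP[? ?]; exists a.
have [b bD [ba vb]] := fcrit_deg2 fD vD aD av.
have [m pm] := fD v vD; have bv : b != v by rewrite eq_sym adj_neq.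
have [|//||[mC ml mb bm] pm'] := @perf_pair _ m D b [:: v]; rewrite ?inE //.
  by rewrite set1_seq.
exists [:: b; m b]; split=> //.
- by rewrite /upath /= vb bm; neqs.
- by apply/allP; rewrite /= vD bD mC.
- by exists m; move: pm'; congr perf; set_bool.
Qed.

(** The mate of a neighbour [u] of [v] sees only [u] and [v], since a further neighbour [z] would
    give the path [v], [u], [m u], [z], [m z]. Minimum degree two makes [m u] adjacent to [v], and
    by connectedness all of [D] is reached: [D] consists of triangles sharing just [v]. *)
Lemma windmill D v m : fcrit D -> v \in D -> ~ sat D v 5 -> perf m (D :\ v) ->
  forall u, u \in D :\ v -> adj v u /\
    (forall z, z \in D -> adj u z -> z = v \/ z = m u).
Proof.
move=> fD vD nsat pm.
have nbr u z : u \in D :\ v -> adj v u -> z \in D -> adj (m u) z ->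
    z = v \/ z = u.
  move=> uDv vu zD uz; have [_ um mm] := pm u uDv.
  have [->|zv] := eqVneq z v; first by left.
  have [->|zu] := eqVneq z u; first by right.
  have uD : u \in D by move: uDv; rewrite inE => /andP[].
  have uv : u != v by rewrite eq_sym adj_neq.
  case: nsat; have [|//||[mC ml mu _] pm'] := @perf_pair _ m D u [:: v].
  - by rewrite set1_seq.
  - by rewrite inE.
  have zmu : z != m u by rewrite eq_sym adj_neq.
  have [] := perf_pair pm' zD; first by rewrite !inE !negb_or zmu zu.
  rewrite !inE !negb_or => -[mzD /and3P[mzmu mzu mzv] mz zmz] pm''.
  exists [:: u; m u; z; m z]; split=> //.
  - by rewrite /upath /= vu um uz zmz; neqs.
  - by apply/allP; rewrite /= vD uD mC zD mzD.
  - by exists m; move: pm''; congr perf; set_bool.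
have vmu u : u \in D :\ v -> adj v u -> adj v (m u).
  move=> uDv vu; have [] := pm u uDv; rewrite !inE => /andP[mv mD] um mm.
  have uD : u \in D by move: uDv; rewrite inE => /andP[].
  have [b bD [bu mub]] := fcrit_deg2 fD mD uD (adj_neq um).
  have [bv|eqbu] := nbr u b uDv vu bD mub; first by rewrite adj_sym -bv.
  by rewrite eqbu eqxx in bu.
have allv u : u \in D :\ v -> adj v u.
  move=> uDv; have uD : u \in D by move: uDv; rewrite inE => /andP[].
  have : u \in v |: [set u in D :\ v | adj v u].
    apply: (fcrit_connected fD _ vD uD); first by rewrite !inE eqxx.
    move=> z t; rewrite in_setU1 in_set => /predU1P[->|/andP[zD vz]] tD zt.
      by rewrite !inE tD zt; case: (t == v).
    have [_ _ mmz] := pm z zD; have [mzD _ _] := pm z zD.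
    have [|->|->] := nbr (m z) t mzD (vmu _ zD vz) tD; rewrite ?mmz //.
      by rewrite !inE eqxx.
    by rewrite in_setU1 in_set mzD vmu ?orbT.
  by rewrite in_setU1 in_set => /predU1P[eqv|/andP[]//]; rewrite eqv !inE eqxx in uDv.
move=> u uDv; split=> [|z zD uz]; first exact: allv.
have [muD _ mmu] := pm u uDv.
by apply: (nbr (m u)) => //; [apply: allv|rewrite mmu].
Qed.

End Windmill.

(** * Factor-critical graphs satisfying the hypothesis *)

Section Critical.
Variables (G : sgraph) (C : {set G}).
Implicit Types (A B D R T X Y : {set G}) (p q ks : seq G) (m : G -> G).
Hypothesis critC : fcrit C.
Hypothesis C_neq0 : C != set0.
Hypothesis weightC : forall X, X \subset C -> weight (C :\: X) <= 2 * #|X|.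
Hypothesis ntiledC : ~ tiled C.

(** For [X] empty the hypothesis forces weight 0, which leaves only the odd orders above 7. *)
Let card_ge9 : 9 <= #|C|.
Proof.
have := fcrit_odd critC C_neq0.
have := leq_trans (weight_ge_wt _) (weightC (sub0set C)).
rewrite cards0 setD0; case: (ltnP 7 #|C|) => [|]; first lia.
by move: #|C|; do 8?case=> //.
Qed.

Let no_gain m B R Y : C = B :|: R -> [disjoint B & R] -> perf m R ->
  Y \subset B ->
  (forall u z, u \in R -> z \in C -> adj u z -> z \in Y \/ z = m u) ->
  4 * #|Y| + 2 <= 2 * weight (B :\: Y) + #|R| -> False.
Proof.
move=> eqC dBR pm sY adjR leg.
have [|X []] := pairs_gain (g := 1) dBR pm sY _ leg; first by rewrite -eqC.
by rewrite -eqC => /weightC + _; clear; lia.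
Qed.

Let no_path p : upath p -> {subset p <= C} -> odd (size p) -> 9 <= size p ->
  matchable (C :\: [set z in p]) -> False.
Proof. by move=> up sp op s9 mp; apply: ntiledC; apply: tiled_path mp. Qed.

Definition scycle m ks :=
  [/\ cycle (@adj G) ks, uniq ks, {subset ks <= C}, odd (size ks)
    & perf m (C :\: [set z in ks])].

Lemma scycle_eqi m ks ks' : scycle m ks -> perm_eq ks' ks ->
  cycle (@adj G) ks' -> scycle m ks'.
Proof.
case=> _ uk sk ok pk eqk ck; split=> //; rewrite ?(perm_uniq eqk) //.
- by move=> z; rewrite (perm_mem eqk); apply: sk.
- by rewrite (perm_size eqk).
- by move: pk; congr perf; apply/setP => z; rewrite !inE (perm_mem eqk).
Qed.

Lemma scycle_rot m ks k : scycle m ks -> k \in ks ->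
  exists2 q, scycle m (k :: q) & perm_eq (k :: q) ks.
Proof.
move=> sck kk; have [i q eqr] := rot_to kk; exists q.
  apply: (scycle_eqi sck); rewrite -eqr ?perm_rot //.
  by rewrite rot_cycle; case: sck.
by rewrite -eqr perm_rot.
Qed.

Lemma scycle_path m k q : scycle m (k :: q) -> upath (k :: q).
Proof.
by case=> /=; rewrite rcons_path => /andP[pk _] uk _ _ _; rewrite /upath /= pk.
Qed.

Let outside ks u := (u \in C) && (u \notin ks).

Lemma cycle_exit m ks : scycle m ks -> ks != [::] -> size ks < #|C| ->
  exists k u, [/\ k \in ks, outside ks u & adj k u].
Proof.
case: ks => // k q [ck uk sk ok pk] _ lts.
have [t tC tk] : exists2 t, t \in C & t \notin k :: q.
  apply/subsetPn; apply: contraTN lts => /subset_leq_card le1.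
  by rewrite -leqNgt -(card_uniqP uk).
apply: NNPP => nex; case/negP: (tk).
have kC : k \in C by apply: sk; rewrite inE eqxx.
suff: t \in [set z in k :: q] by rewrite inE.
apply: fcrit_connected kC tC _ => //; first by rewrite !inE eqxx.
move=> z t' ; rewrite !in_set => zk t'C zt'; apply/negPn/negP => t'k.
by case: nex; exists z, t'; split=> //; rewrite /outside t'C.
Qed.

Lemma out_mate m ks u : scycle m ks -> outside ks u ->
  [/\ outside ks (m u), adj u (m u), m (m u) = u & m u != u].
Proof.
case=> _ _ _ _ pk /andP[uC uk].
have [|] := pk u; rewrite ?inE ?uk // => /andP[mk mC] um mm.
by rewrite /outside mC mk; split=> //; rewrite eq_sym adj_neq.
Qed.

(** A cycle of length at least 9, opened anywhere, is a forbidden path. A cycle of length 7 does not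
    exhaust [C]; opened at a vertex that sees an outside pair and prolonged by that pair, it has
    order 9. *)
Lemma short_cycle m ks : scycle m ks -> size ks < 7.
Proof.
move=> sc; rewrite ltnNge; apply/negP => le7.
have [le9|lt9] := leqP 9 (size ks).
  case: ks sc le7 le9 => // k q sc _ le9; apply: (no_path (scycle_path sc)) => //.
  - by case: sc.
  - by case: sc.
  - by exists m; case: sc.
have [||k [u [kk /andP[uC uk] ku]]] := cycle_exit sc.
- by case: (ks) le7.
- exact: leq_trans lt9 card_ge9.
have [q scq eqq] := scycle_rot sc kk; have upq := scycle_path scq.
have [_ _ sq oq pq] := scq.
have [||[mC mq mu um] pq'] := perf_pair pq (u := u) => //.
  by rewrite (perm_mem eqq).
have uq : u \notin k :: q by rewrite (perm_mem eqq).
apply: (no_path (p := m u :: u :: k :: q)).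
- move: upq; rewrite !upath_cons /= [adj (m u) u]adj_sym um [adj u k]adj_sym ku.
  by case/and3P => -> -> ->; neqs.
- by move=> z /predU1P[->//|/predU1P[->//|]]; apply: sq.
- by rewrite /= !negbK.
- by have := perm_size eqq; move: le7; clear => /=; lia.
- by exists m.
Qed.

(** * Excluding saturated cycles of length five *)

Section Long.
Variables (m : G -> G) (ks : seq G).
Hypothesis sck : scycle m ks.
Hypothesis le5 : 5 <= size ks.

(** Otherwise [m w], [w], [m u], [u], [k] and the rest of the opened cycle form a path of order at
    least 4 + 5. *)
Lemma mate_neighbor k u w : k \in ks -> outside ks u -> adj k u -> outside ks w ->
  adj (m u) w -> w = u.
Proof.
move=> kk ou ku ow muw; apply/eqP/negPn/negP => wu.
have [q scq eqq] := scycle_rot sck kk; have upq := scycle_path scq.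
have [_ _ sq oq pq] := scq; have memq := perm_mem eqq.
have [/andP[muC muk] um mm mu] := out_mate sck ou.
have [/andP[mwC mwk] wm mmw mw] := out_mate sck ow.
have /andP[uC uk] := ou; have /andP[wC wk] := ow.
rewrite -!memq in uk wk muk mwk.
have [_ pq'] := perf_pair pq uC uk.
have wl : w \notin m u :: u :: k :: q.
  rewrite in_cons negb_or [w \in u :: _]in_cons negb_or wk wu !andbT.
  by rewrite eq_sym adj_neq.
have [[_ mwl _ _] pq''] := perf_pair pq' wC wl.
apply: (no_path (p := m w :: w :: m u :: u :: k :: q)).
- have := upq; rewrite !upath_cons /= [adj (m w) w]adj_sym wm.
  rewrite [adj w _]adj_sym muw [adj (m u) u]adj_sym um [adj u k]adj_sym ku.
  case/and3P=> -> -> ->; rewrite !in_cons in uk wk muk mwk mwl *.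
  by neqs.
- by move=> z; do 4 (case/predU1P=> [->//|]); apply: sq.
- by rewrite /= !negbK.
- by have := perm_size eqq; move: le5; clear => /=; lia.
- by exists m.
Qed.

Lemma mate_attached k u : k \in ks -> outside ks u -> adj k u ->
  exists2 k', k' \in ks & adj k' (m u).
Proof.
move=> kk ou ku; have [/andP[muC muk] um mm mu] := out_mate sck ou.
have /andP[uC uk] := ou.
have [b bC [bu mub]] := fcrit_deg2 critC muC uC (adj_neq um).
have [bk|bk] := boolP (b \in ks); first by exists b; rewrite // adj_sym.
by case/eqP: bu; apply: (mate_neighbor kk ou ku) => //; rewrite /outside bC.
Qed.

(** Attachment spreads along edges: the mate of an attached vertex is attached by [mate_attached],
    and by [mate_neighbor] the mate is its only neighbour off the cycle. Connectedness does the
    rest. *)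
Lemma all_attached u : outside ks u -> exists2 k, k \in ks & adj k u.
Proof.
move=> /andP[uC uk]; have [k kk] : exists k, k \in ks.
  by case: (ks) le5 => // k q _; exists k; rewrite inE eqxx.
have kC : k \in C by case: sck => _ _ + _ _; apply.
pose Att := [set z in C | (z \in ks) || has (fun k => adj k z) ks].
have : u \in Att.
  apply: (fcrit_connected critC _ kC uC); first by rewrite inE kC kk.
  move=> z t; rewrite !inE => /andP[zC zA] tC zt; rewrite tC /=.
  have [zk|zk] := boolP (z \in ks).
    by apply/orP; right; apply/hasP; exists z.
  move: zA; rewrite (negPf zk) => /hasP[k' k'k k'z].
  have oz : outside ks z by rewrite /outside zC.
  have [k'' k''k k''mz] := mate_attached k'k oz k'z.
  have [omz _ mmz _] := out_mate sck oz.
  have [//|tk] := boolP (t \in ks).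
  have -> : t = m z.
    by apply: (mate_neighbor k''k omz k''mz); rewrite ?mmz // /outside tC.
  by apply/hasP; exists k''.
by rewrite inE uC (negPf uk) => /hasP.
Qed.

Lemma out_adj u z : outside ks u -> z \in C -> adj u z -> z \in ks \/ z = m u.
Proof.
move=> ou zC uz; have [zk|zk] := boolP (z \in ks); [by left|right].
have [omu _ mmu _] := out_mate sck ou.
have [k kk kmu] := all_attached omu.
by apply: (mate_neighbor kk omu kmu); rewrite ?mmu // /outside zC.
Qed.

End Long.

(** If distinct [u] and [w] are mates, they can be inserted between [k1] and [k2], and the cycle
    becomes too long. If not, the cycle cut between [k1] and [k2] is prolonged at both ends by their
    pairs, to order at least 5 + 4. *)
Lemma no_consecutive m k1 k2 q u w : scycle m (k1 :: k2 :: q) ->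
  3 <= size q -> outside (k1 :: k2 :: q) u -> outside (k1 :: k2 :: q) w ->
  adj k1 u -> adj k2 w -> u = w.
Proof.
move=> sc le3 ou ow k1u k2w; apply/eqP/negPn/negP => uw.
have [ck uk sk ok pk] := sc; set ks := _ :: _ in sc ou ow sk pk.
have [/andP[muC muk] um mm mu] := out_mate sc ou.
have [/andP[mwC mwk] wm mmw mw] := out_mate sc ow.
have /andP[uC uks] := ou; have /andP[wC wks] := ow.
have [_ pk'] := perf_pair pk uC uks.
have uk2 : u \notin k2 :: q by move: uks; rewrite in_cons negb_or => /andP[].
have wk2 : w \notin k2 :: q by move: wks; rewrite in_cons negb_or => /andP[].
have [eqw|wmu] := eqVneq w (m u).
  have scn : scycle m (k1 :: u :: w :: k2 :: q).
    split.
    - move: ck; rewrite /= k1u [adj w k2]adj_sym k2w eqw um.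
      by case/andP.
    - move: uk uk2 wk2 uks wks; rewrite cons_uniq => /andP[k1k uk] uk2 wk2 uks wks.
      rewrite cons_uniq [uniq (u :: _)]cons_uniq [uniq (w :: _)]cons_uniq uk wk2.
      by rewrite /ks in uks wks; clear -k1k uks wks k1u uk2 uw; rewrite !in_cons; neqs.
    - move=> z; rewrite 3!in_cons => /or4P[/eqP->|/eqP->//|/eqP->//|zk].
        by apply: sk; rewrite inE eqxx.
      by apply: sk; rewrite inE zk orbT.
    - by rewrite /= !negbK in ok *.
    - by move: pk'; rewrite -eqw; congr perf; rewrite /ks; set_bool.
  by have := short_cycle scn; move: le3; clear => /=; lia.
have wl : w \notin m u :: u :: ks 
  by rewrite in_cons negb_or [w \in u :: _]in_cons negb_or wks wmu eq_sym uw.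
have [[_ mwl _ _] pk''] := perf_pair pk' wC wl.
have eqp : perm_eq (m w :: w :: k2 :: rcons q k1 ++ [:: u; m u])
                   (m w :: w :: m u :: u :: ks).
  rewrite !perm_cons; apply/permP => P; rewrite /= count_cat -cats1 count_cat /=.
  by clear; lia.
apply: (no_path (p := m w :: w :: k2 :: rcons q k1 ++ [:: u; m u])).
- rewrite /upath; apply/andP; split.
    rewrite /= cat_path /= last_rcons k1u um [adj (m w) w]adj_sym wm.
    by rewrite [adj w k2]adj_sym k2w !andbT; move: ck => /andP[].
  rewrite (perm_uniq eqp) cons_uniq in_cons negb_or mw mwl cons_uniq wl /=.
  by rewrite [_ \in _ :: _]in_cons negb_or mu muk uks.
- move=> z; rewrite (perm_mem eqp).
  by do 4 (case/predU1P=> [->//|]); apply: sk.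
- by rewrite (perm_size eqp) /= !negbK in ok *.
- by rewrite (perm_size eqp) /ks; move: le3; clear => /=; lia.
- exists m; move: pk''; congr perf; apply/setP => z.
  by rewrite !in_setD !in_set (perm_mem eqp).
Qed.

Section Five.
Variables (m : G -> G) (a1 a2 a3 a4 a5 : G).
Let ks := [:: a1; a2; a3; a4; a5].
Hypothesis sc : scycle m ks.

Lemma five_rot : scycle m [:: a2; a3; a4; a5; a1].
Proof.
apply: scycle_eqi sc _ _; first exact: permEl (perm_rot 1 ks).
by have := rot_cycle 1 (@adj G) ks; rewrite /rot /= => ->; case: sc.
Qed.

Lemma five_rest : [/\ C = [set z in ks] :|: (C :\: [set z in ks]),
  [disjoint [set z in ks] & C :\: [set z in ks]]
  & 4 <= #|C :\: [set z in ks]| ].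
Proof.
have [_ uk sk _ _] := sc.
have sK : [set z in ks] \subset C by apply/subsetP => z; rewrite inE; apply: sk.
split; first by rewrite -{1}(setID C [set z in ks]) (setIidPr sK).
  by rewrite disjoints_subset setCD subsetUr.
rewrite cardsD (setIidPr sK) cardsE (card_uniqP uk).
by move: card_ge9; clear => /=; lia.
Qed.

Lemma five_only13 : (forall u, outside ks u ->
  forall a, a \in ks -> adj u a -> a = a1 \/ a = a3) -> False.
Proof.
move=> only; have [eqC dC leR] := five_rest.
have [_ uk sk _ pk] := sc.
have sY : [set a1; a3] \subset [set z in ks].
  by rewrite subUset !sub1set !inE !eqxx ?orbT.
apply: (no_gain eqC dC pk sY).
- move=> u z; rewrite in_setD in_set => /andP[uks uC] zC uz.
  have ou : outside ks u by rewrite /outside uC uks.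
  have [zk|] := out_adj sc isT ou zC uz; last by right.
  by left; rewrite !inE; have [->|->] := only u ou z zk uz; rewrite eqxx ?orbT.
(* Three vertices of the cycle remain, of weight at least 3 however they split. With at least four
   vertices outside, the bound to meet is 8 + 2 <= 6 + 4. *)
- have c2 : #|[set a1; a3]| = 2.
    by rewrite cards2; move: uk; rewrite /= !inE !negb_or => /and5P[/and4P[_ ->]].
  have : wt 3 <= weight ([set z in ks] :\: [set a1; a3]).
    apply: leq_trans (weight_ge_wt _).
    by rewrite cardsD (setIidPr sY) c2 cardsE (card_uniqP uk).
  by move: leR; rewrite c2 /wt /=; clear; lia.
Qed.

End Five.

Lemma outside_rot a b c d e z :
  outside [:: a; b; c; d; e] z -> outside [:: b; c; d; e; a] z.
Proof.
by rewrite /outside !inE !negb_or => /and5P[-> -> -> -> /andP[-> ->]].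
Qed.

(** By [no_consecutive], outside vertices other than [u] see at most [a4] on the cycle; [m u] does
    see it, so [u] sees neither [a3] nor [a5]. Deleting [a1], [a2], [a4] then isolates [a3] from
    [a5]: an edge between them would close a cycle of length 7 through [u] and [m u]. *)
Lemma five_no12 m a1 a2 a3 a4 a5 u : scycle m [:: a1; a2; a3; a4; a5] ->
  outside [:: a1; a2; a3; a4; a5] u -> adj a1 u -> adj a2 u -> False.
Proof.
move=> sc ou a1u a2u; have [eqC dC leR] := five_rest sc.
have sc2 := five_rot sc; have sc3 := five_rot sc2.
have sc4 := five_rot sc3; have sc5 := five_rot sc4.
have nc12 := no_consecutive sc isT; have nc23 := no_consecutive sc2 isT.
have nc34 := no_consecutive sc3 isT; have nc45 := no_consecutive sc4 isT.
have nc51 := no_consecutive sc5 isT.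
have [omu um mmu mu] := out_mate sc ou.
have other w : outside [:: a1; a2; a3; a4; a5] w -> w != u ->
    forall a, a \in [:: a1; a2; a3; a4; a5] -> adj w a -> a = a4.
  move=> ow wu a; rewrite !inE.
  move=> /or4P[/eqP->|/eqP->|/eqP->|/orP[/eqP->//|/eqP->]]; rewrite adj_sym => aw;
    case/eqP: wu.
  - by rewrite (nc12 w u).
  - by rewrite (nc12 u w).
  - by rewrite (nc23 u w) //; apply: outside_rot.
  - by rewrite (nc51 w u) //; do 4 apply: outside_rot.
have [a ak amu] := all_attached sc isT omu.
have a4mu : adj a4 (m u).
  by rewrite adj_sym in amu; rewrite adj_sym -(other _ omu mu a ak amu).
have adj_out v z : outside [:: a1; a2; a3; a4; a5] v -> z \in C -> adj v z ->
    z \in [set a1; a2; a4] \/ z = m v.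
  move=> ov zC vz; have [zk|] := out_adj sc isT ov zC vz; last by right.
  left; have [eqv|vu] := eqVneq v u; last first.
    by rewrite (other v ov vu z zk vz) !inE eqxx !orbT.
  move: zk; rewrite !inE eqv in vz *.
  move=> /or4P[->//|->|/eqP eqz|/orP[->|/eqP eqz]]; rewrite ?orbT //;
    rewrite eqz adj_sym in vz; case/eqP: mu.
  - by rewrite -(nc34 u (m u)) //; do 2 apply: outside_rot.
  - by rewrite (nc45 (m u) u) //; do 3 apply: outside_rot.
have [ck uk sk _ pk] := sc.
have a35 : ~~ adj a3 a5.
  apply/negP => a35; have [/andP[muC muk] /andP[uC uks]] := (omu, ou).
  have [_ pk'] := perf_pair pk uC uks.
  have /short_cycle : scycle m [:: a4; m u; u; a1; a2; a3; a5]; last by [].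
  have eqp : perm_eq [:: a4; m u; u; a1; a2; a3; a5]
                     [:: m u; u; a1; a2; a3; a4; a5].
    by apply/permP => P /=; clear; lia.
  split=> //.
  - rewrite /= a4mu [adj (m u) u]adj_sym um [adj u a1]adj_sym a1u a35.
    by move: ck => /= /and5P[-> -> _ a45 _]; rewrite adj_sym a45.
  - rewrite (perm_uniq eqp) cons_uniq [uniq (u :: _)]cons_uniq uks uk.
    by rewrite in_cons negb_or mu muk.
  - move=> z; rewrite (perm_mem eqp).
    by do 2 (case/predU1P=> [->//|]); apply: sk.
  - by move: pk'; congr perf; set_bool.
have sY : [set a1; a2; a4] \subset [set z in [:: a1; a2; a3; a4; a5]].
  by rewrite !subUset !sub1set !inE !eqxx ?orbT.
apply: (no_gain eqC dC pk sY).
- move=> v z; rewrite in_setD in_set => /andP[vk vC] zC vz.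
  by apply: adj_out; rewrite // /outside vC.
- have c3 : #|[set a1; a2; a4]| <= 3.
    by rewrite setUC cardsU1 cards2; do 2 case: (~~ _).
  have : 6 <= weight ([set z in [:: a1; a2; a3; a4; a5]] :\: [set a1; a2; a4]).
    rewrite (_ : [set z in _] = [set a1; a2; a4] :|: ([set a3] :|: [set a5])); last first.
      by set_bool.
    rewrite setDUl setDv set0U (setDidPl _).
      apply: leq_trans (weightU _ _).
      - by apply: (leq_add (m1 := 3) (m2 := 3)); apply: leq_trans (weight_ge_wt _);
          rewrite cards1.
      - rewrite disjoints_subset sub1set !inE.
        by move: uk; rewrite /= !inE !negb_or => uk5; clear -uk5; neqs.
      - by move=> x y; rewrite !inE => /eqP-> /eqP->.
    rewrite disjoints_subset subUset !sub1set !inE !negb_or.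
    by move: uk; rewrite /= !inE !negb_or => uk5; clear -uk5; neqs.
  by move: leR c3; clear; lia.
Qed.


Lemma no_five m a1 a2 a3 a4 a5 : ~ scycle m [:: a1; a2; a3; a4; a5].
Proof.
move=> sc; pose att a := [exists u, outside [:: a1; a2; a3; a4; a5] u && adj a u].
have sc2 := five_rot sc; have sc3 := five_rot sc2.
have sc4 := five_rot sc3; have sc5 := five_rot sc4.
have cons b1 b2 b3 b4 b5 : scycle m [:: b1; b2; b3; b4; b5] ->
    outside [:: b1; b2; b3; b4; b5] =1 outside [:: a1; a2; a3; a4; a5] ->
    att b1 -> att b2 -> False.
  move=> scb oE /existsP[u /andP[ou b1u]] /existsP[w /andP[ow b2w]].
  rewrite -!oE in ou ow; have equw := no_consecutive scb isT ou ow b1u b2w.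
  by apply: (five_no12 scb ou b1u); rewrite equw.
have only b1 b2 b3 b4 b5 : scycle m [:: b1; b2; b3; b4; b5] ->
    outside [:: b1; b2; b3; b4; b5] =1 outside [:: a1; a2; a3; a4; a5] ->
    [&& ~~ att b2, ~~ att b4 & ~~ att b5] -> False.
  move=> scb oE /and3P[n2 n4 n5]; apply: (five_only13 scb) => u ou a.
  have aE : adj u a -> att a.
    by move=> ua; apply/existsP; exists u; rewrite -oE ou adj_sym.
  rewrite !inE => ab /aE; move: ab.
  by move=> /or4P[/eqP->|/eqP->|/eqP->|/orP[] /eqP->];
    rewrite ?(negPf n2) ?(negPf n4) ?(negPf n5); auto.
have o2 : outside [:: a2; a3; a4; a5; a1] =1 outside [:: a1; a2; a3; a4; a5].
  by move=> z; rewrite /outside !inE; btauto.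
have o3 : outside [:: a3; a4; a5; a1; a2] =1 outside [:: a1; a2; a3; a4; a5].
  by move=> z; rewrite /outside !inE; btauto.
have o4 : outside [:: a4; a5; a1; a2; a3] =1 outside [:: a1; a2; a3; a4; a5].
  by move=> z; rewrite /outside !inE; btauto.
have o5 : outside [:: a5; a1; a2; a3; a4] =1 outside [:: a1; a2; a3; a4; a5].
  by move=> z; rewrite /outside !inE; btauto.
have := (cons _ _ _ _ _ sc (frefl _), cons _ _ _ _ _ sc2 o2,
  cons _ _ _ _ _ sc3 o3, cons _ _ _ _ _ sc4 o4, cons _ _ _ _ _ sc5 o5).
have := (only _ _ _ _ _ sc (frefl _), only _ _ _ _ _ sc2 o2,
  only _ _ _ _ _ sc3 o3, only _ _ _ _ _ sc4 o4, only _ _ _ _ _ sc5 o5).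
clear; move=> [[[[p1 p2] p3] p4] p5] [[[[q1 q2] q3] q4] q5].
(* No two consecutive vertices are attached, so after a rotation the attached ones lie in positions
   1 and 3, which [only] excludes. All 32 cases are tried. *)
by move: (att a1) (att a2) (att a3) (att a4) (att a5) p1 p2 p3 p4 p5 q1 q2 q3 q4 q5;
  do 5 case; auto.
Qed.

Lemma scycle_size m ks : scycle m ks -> size ks <= 4.
Proof.
move=> sc; rewrite leqNgt; apply/negP => le5; have le6 := short_cycle sc.
have [_ _ _ ok _] := sc.
case: ks sc le5 le6 ok => // a1 [|a2 [|a3 [|a4 [|a5 [|a6 [|a7 ?]]]]]] sc // _ _ _.
exact: no_five sc.
Qed.

Lemma no_long_cycle q : cycle (@adj G) q -> uniq q -> {subset q <= C} ->
  odd (size q) -> 5 <= size q -> matchable (C :\: [set z in q]) -> False.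
Proof.
move=> cq uq sq oq le5 [m pq]; have sc : scycle m q by [].
by have := scycle_size sc; rewrite leqNgt le5.
Qed.

(** The alternating path from [v] to [u] ends with the edge from [m u] to [u]; closed by the edge
    from [u] to [v] it is a saturated odd cycle. Its length must be 3, so [m u] comes directly after
    [v]. *)
Lemma mate_adj m v u : v \in C -> perf m (C :\ v) -> u \in C -> adj v u ->
  adj v (m u).
Proof.
move=> vC pm uC vu; have [m2 pm2] := critC uC.
have [p [up sp op pp]] := alternating_path vC uC (adj_neq vu) pm pm2.
case: p up sp op pp => [|p1 p] up sp op pp; first by case/andP: up => /andP[].
case: (@no_long_cycle (v :: rcons (rcons (p1 :: p) (m u)) u)) => //.
- move: up; rewrite upath_cons => /and3P[pu _ _].
  by rewrite /cycle rcons_path pu last_rcons adj_sym.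
- by case/andP: up.
- by rewrite /= !size_rcons /= !negbK in op *.
- by rewrite /= !size_rcons; case: (p) op.
- by exists m.
Qed.

(** * Saturated triangles *)

Section Triangles.

Definition swap m a b (x : G) := if x == a then b else if x == b then a else m x.

Definition attached ks u := has (fun k => adj k u) ks.
Arguments attached : simpl never.

Lemma attachedP ks u : reflect (exists2 k, k \in ks & adj k u) (attached ks u).
Proof. exact: hasP. Qed.

Section Triangle.
Variables (m : G -> G) (k1 k2 k3 : G).
Hypothesis sc : scycle m [:: k1; k2; k3].
Let ks := [:: k1; k2; k3].

Lemma tri_adj : [/\ adj k1 k2, adj k2 k3 & adj k3 k1].
Proof. by case: sc => /= /and4P[]. Qed.

Lemma tri_in : [/\ k1 \in C, k2 \in C & k3 \in C].
Proof. by case: sc => _ _ s _ _; split; apply: s; rewrite !inE eqxx ?orbT. Qed.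

Lemma tri_rot : scycle m [:: k2; k3; k1].
Proof.
apply: scycle_eqi sc _ _; first exact: permEl (perm_rot 1 ks).
by have := rot_cycle 1 (@adj G) ks; rewrite /rot /= => ->; case: sc.
Qed.

Lemma swap_out u : outside ks u -> swap m k2 k3 u = m u.
Proof.
by rewrite /outside /swap !inE !negb_or => /and4P[_ _ /negPf-> /negPf->].
Qed.

Lemma swap_perf : perf (swap m k2 k3) (C :\ k1).
Proof.
have [_ _ _ _ pk] := sc; have [k12 k23 k31] := tri_adj; have [? k2C k3C] := tri_in.
move=> u; rewrite in_setD1 => /andP[uk1 uC]; rewrite /swap in_setD1.
have [->|uk2] := eqVneq u k2.
  by rewrite eqxx [k3 == k2]eq_sym (negPf (adj_neq k23)) adj_neq.
have [->|uk3] := eqVneq u k3.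
  by rewrite !eqxx [k2 == k1]eq_sym adj_neq // adj_sym.
have [|] := out_mate (u := u) sc; first by rewrite /outside uC !inE negb_or uk1 negb_or uk2.
case/andP => muC; rewrite !inE !negb_or => /and3P[/negPf-> /negPf-> /negPf->].
by rewrite muC.
Qed.

Lemma tri_mate u : outside ks u -> adj k1 u -> adj k1 (m u).
Proof.
move=> ou k1u; have [k1C _ _] := tri_in; have /andP[uC _] := ou.
by rewrite -(swap_out ou); apply: mate_adj swap_perf uC k1u.
Qed.

(** A pendant triangle at [k1] can take the place of the central one, [k2] and [k3] becoming a
    matched pair. *)
Lemma tri_out u : outside ks u -> adj k1 u -> scycle (swap m k2 k3) [:: k1; u; m u].
Proof.
move=> ou k1u; have k1mu := tri_mate ou k1u; have [/andP[muC muk] um mm mu] := out_mate sc ou.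
have [k1C _ _] := tri_in; have /andP[uC uk] := ou.
split=> //.
- by rewrite /= k1u um adj_sym k1mu.
- by rewrite /= !inE negb_or (adj_neq k1u) (adj_neq k1mu) adj_neq.
- by apply/allP; rewrite /= k1C uC muC.
- have [|||_] := @perf_pair _ (swap m k2 k3) C u [:: k1].
  + by rewrite set1_seq; apply: swap_perf.
  + by [].
  + by rewrite inE eq_sym adj_neq.
  by rewrite (swap_out ou); congr perf; set_bool.
Qed.

(** A common neighbour would give the saturated 5-cycle [k1], [m u], [u], [k2], [k3]. *)
Lemma tri_excl u : outside ks u -> adj k1 u -> ~~ adj k2 u.
Proof.
move=> ou k1u; apply/negP => k2u; have k1mu := tri_mate ou k1u.
have [/andP[muC muk] um mm mu] := out_mate sc ou; have /andP[uC uk] := ou.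
have [ck uks sk _ pk] := sc; have [_ pk'] := perf_pair pk uC uk.
have [k1C k2C k3C] := tri_in; have [k12 k23 k31] := tri_adj.
have eqp : perm_eq [:: k1; m u; u; k2; k3] [:: m u; u; k1; k2; k3].
  by apply/permP => P /=; clear; lia.
apply: (@no_long_cycle [:: k1; m u; u; k2; k3]) => //.
- by rewrite /= k1mu [adj (m u) u]adj_sym um adj_sym k2u k23 k31.
- by rewrite (perm_uniq eqp) cons_uniq in_cons negb_or mu muk cons_uniq uk.
- by apply/allP; rewrite /= k1C muC uC k2C k3C.
- by exists m; move: pk'; congr perf; set_bool.
Qed.

End Triangle.

Lemma attached_rot a b c u : attached [:: b; c; a] u = attached [:: a; b; c] u.
Proof. by rewrite /attached /=; btauto. Qed.

Lemma outside_rot3 a b c u : outside [:: b; c; a] u = outside [:: a; b; c] u.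
Proof. by rewrite /outside !inE; btauto. Qed.

Section TriangleEdges.
Variables (m : G -> G) (k1 k2 k3 : G).
Hypothesis sc : scycle m [:: k1; k2; k3].
Let ks := [:: k1; k2; k3].

Lemma tri_two_pairs u w : outside ks u -> outside ks w -> w != u -> w != m u ->
  [/\ perf m (C :\: [set z in [:: m w; w; m u; u; k1; k2; k3]]),
      {subset [:: m w; w; m u; u; k1; k2; k3] <= C}
    & uniq [:: m w; w; m u; u; k1; k2; k3]].
Proof.
move=> ou ow wu wmu; have [ck uks sk _ pk] := sc.
have [/andP[muC muk] um mm mu] := out_mate sc ou; have /andP[uC uk] := ou.
have [/andP[mwC mwk] wm mmw mw] := out_mate sc ow; have /andP[wC wk] := ow.
have [_ pk'] := perf_pair pk uC uk.
have wl : w \notin [:: m u; u; k1; k2; k3].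
  by rewrite in_cons negb_or wmu in_cons negb_or wu.
have [[_ mwl _ _] pk''] := perf_pair pk' wC wl; split=> //.
  by move=> z; do 4 (case/predU1P=> [->//|]); apply: sk.
rewrite cons_uniq in_cons negb_or mw mwl cons_uniq wl cons_uniq in_cons negb_or.
by rewrite mu muk cons_uniq uk.
Qed.

(** Otherwise [k1], [m u], [u], [w], [m w] is a 5-cycle, saturated because [k2] and [k3] join the
    matching of the rest. *)
Lemma tri_pair u w : outside ks u -> outside ks w -> adj k1 u -> adj k1 w ->
  adj u w -> w = m u.
Proof.
move=> ou ow k1u k1w uw; apply/eqP/negPn/negP => wmu.
have [|pk sl ul] := tri_two_pairs ou ow _ wmu; first by rewrite eq_sym adj_neq.
have [_ um _ _] := out_mate sc ou; have [_ wm _ _] := out_mate sc ow.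
have [k12 k23 k31] := tri_adj sc; have [k1C k2C k3C] := tri_in sc.
have eqp : perm_eq [:: k2; k3; k1; m u; u; w; m w] [:: m w; w; m u; u; k1; k2; k3].
  by apply/permP => P /=; clear; lia.
apply: (@no_long_cycle [:: k1; m u; u; w; m w]) => //.
- rewrite /= (tri_mate sc ou k1u) [adj (m u) u]adj_sym um uw wm adj_sym.
  by rewrite (tri_mate sc ow k1w).
- by move: ul; rewrite -(perm_uniq eqp) => /and3P[].
- by move=> z zl; apply: sl; rewrite -(perm_mem eqp) 2!in_cons zl !orbT.
- move: ul; rewrite -(perm_uniq eqp) => /and3P[k2l k3l _].
  apply: (matchable_drop k23 k2C k3C _ k3l).
    by move: k2l; rewrite in_cons negb_or => /andP[].
  by exists m; move: pk; congr perf; apply/setP => z; rewrite !in_setD !in_set (perm_mem eqp).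
Qed.

(** Since mates are attached to the same vertex, such an edge closes the 7-cycle [k1], [m u], [u],
    [w], [m w], [k2], [k3]. *)
Lemma tri_cross u w : outside ks u -> outside ks w -> adj k1 u -> adj k2 w ->
  ~~ adj u w.
Proof.
move=> ou ow k1u k2w; apply/negP => uw.
have wmu : w != m u.
  apply: contraTneq k2w => ->; have [omu _ _ _] := out_mate sc ou.
  exact: (tri_excl sc omu (tri_mate sc ou k1u)).
have [|pk sl ul] := tri_two_pairs ou ow _ wmu; first by rewrite eq_sym adj_neq.
have [_ um _ _] := out_mate sc ou; have [_ wm _ _] := out_mate sc ow.
have [k12 k23 k31] := tri_adj sc; have [k1C k2C k3C] := tri_in sc.
have eqp : perm_eq [:: k1; m u; u; w; m w; k2; k3] [:: m w; w; m u; u; k1; k2; k3].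
  by apply/permP => P /=; clear; lia.
have k2mw : adj k2 (m w).
  by apply: (tri_mate (tri_rot sc)) k2w; rewrite outside_rot3.
apply: (@no_long_cycle [:: k1; m u; u; w; m w; k2; k3]) => //.
- rewrite /= (tri_mate sc ou k1u) [adj (m u) u]adj_sym um uw wm k23 k31.
  by rewrite adj_sym k2mw.
- by rewrite (perm_uniq eqp).
- by move=> z; rewrite (perm_mem eqp); apply: sl.
- by exists m; move: pk; congr perf; apply/setP => z; rewrite !in_setD !in_set (perm_mem eqp).
Qed.

(** By [tri_out] the triangle [u], [m u], [k1] is saturated too, and [tri_mate] applies to it at
    [u]. *)
Lemma tri_chain u w : outside ks u -> adj k1 u -> outside ks w -> adj u w ->
  w != m u -> adj u (m w).
Proof.
move=> ou k1u ow uw wmu; rewrite -(swap_out m ow).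
have sc' := tri_rot (tri_out sc ou k1u).
apply: (tri_mate sc' _ uw); rewrite /outside; have /andP[-> /=] := ow.
by move=> wks; rewrite /ks in wks; clear -wks uw wmu; neqs.
Qed.

End TriangleEdges.

(** By connectedness some unattached [w] has an attached neighbour [u]; a rotation of the triangle
    makes [b1] the vertex that sees [u]. *)
Lemma tri_deep m k1 k2 k3 z : scycle m [:: k1; k2; k3] ->
  outside [:: k1; k2; k3] z -> ~~ attached [:: k1; k2; k3] z ->
  exists b1 b2 b3 u w, let b := [:: b1; b2; b3] in
    [/\ scycle m b, b =i [:: k1; k2; k3], outside b u & adj b1 u] /\
    [/\ outside b w, ~~ attached b w & adj u w].
Proof.
move=> sc oz nz; apply: NNPP => nex.
have [k1C k2C k3C] := tri_in sc; have /andP[zC zk] := oz.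
suff: z \in [set t in C | (t \in [:: k1; k2; k3]) || attached [:: k1; k2; k3] t].
  by rewrite inE (negPf zk) (negPf nz) andbF.
apply: (fcrit_connected critC _ k1C zC); first by rewrite !inE eqxx k1C.
move=> u w; rewrite !in_set => /andP[uC uA] wC uw; rewrite wC /=.
apply/negPn/negP; rewrite negb_or => /andP[wk nw]; case: nex.
have [uk|uk] := boolP (u \in [:: k1; k2; k3]).
  by case/negP: nw; apply/(attachedP [:: k1; k2; k3]); exists u.
have ow : outside [:: k1; k2; k3] w by rewrite /outside wC.
have ou : outside [:: k1; k2; k3] u by rewrite /outside uC.
rewrite (negPf uk) /attached /= orbF in uA; case/or3P: uA => ku.
- by exists k1, k2, k3, u, w.
- exists k2, k3, k1, u, w; cbv zeta.
  rewrite !(outside_rot3 k1 k2 k3) (attached_rot k1 k2 k3).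
  by split; split=> //; [exact: tri_rot|move=> t; rewrite !inE; btauto].
- exists k3, k1, k2, u, w; cbv zeta.
  rewrite !(outside_rot3 k2 k3 k1) !(outside_rot3 k1 k2 k3).
  rewrite (attached_rot k2 k3 k1) (attached_rot k1 k2 k3).
  by split; split=> //; [do 2 apply: tri_rot|move=> t; rewrite !inE; btauto].
Qed.

Lemma exists_tri : exists m k1 k2 k3, scycle m [:: k1; k2; k3].
Proof.
have [v vC] := set0Pn _ C_neq0; have [m pm] := critC vC.
have [a aC av] : exists2 a, a \in C & a != v.
  have : 0 < #|C :\ v| by have := card_ge9; rewrite (cardsD1 v) vC; clear; lia.
  by rewrite card_gt0 => /set0Pn[a]; rewrite in_setD1 => /andP[? ?]; exists a.
have [u uC [_ vu]] := fcrit_deg2 critC vC aC av.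
have [|||[muC muv mu um] pm'] := @perf_pair _ m C u [:: v] => //.
- by rewrite set1_seq.
- by rewrite inE eq_sym adj_neq.
have vmu := mate_adj vC pm uC vu.
exists m, v, u, (m u); split=> //.
- by rewrite /= vu um adj_sym vmu.
- by rewrite /= !inE negb_or (adj_neq vu) (adj_neq vmu) adj_neq.
- by apply/allP; rewrite /= vC uC muC.
- by move: pm'; congr perf; set_bool.
Qed.

(** Without a hub, choose [w] at distance two from a triangle, via [u], pass to the triangle [k1],
    [u], [m u], and choose [y] at distance two from this one, via [x]. The path [m' y], [y], [x],
    [m' x] enters the new triangle, runs through its three vertices and leaves along one more pair:
    order 4 + 3 + 2 = 9. *)
Lemma exists_hub : exists m k1 k2 k3, scycle m [:: k1; k2; k3] /\
  forall z, outside [:: k1; k2; k3] z -> attached [:: k1; k2; k3] z.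
Proof.
have [m [c1 [c2 [c3 sc0]]]] := exists_tri; apply: NNPP => nex.
have deep m' b1 b2 b3 (scb : scycle m' [:: b1; b2; b3]) :
    exists z, outside [:: b1; b2; b3] z /\ ~~ attached [:: b1; b2; b3] z.
  apply: NNPP => nz; apply: nex; exists m', b1, b2, b3; split=> // z oz.
  by apply/negPn/negP => az; apply: nz; exists z.
have [z0 [oz0 nz0]] := deep _ _ _ _ sc0.
have [k1 [k2 [k3 [u [w [[sc _ ou k1u] [ow nw uw]]]]]]] := tri_deep sc0 oz0 nz0.
have sc' := tri_out sc ou k1u; set m' := swap m k2 k3 in sc'.
have [z1 [oz1 nz1]] := deep _ _ _ _ sc'.
have [b1 [b2 [b3 [x [y [[scb eqb ox b1x] [oy ny xy]]]]]]] := tri_deep sc' oz1 nz1.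
have b1x' := tri_mate scb ox b1x.
have [_ yy' _ _] := out_mate scb oy; have [_ xx' _ _] := out_mate scb ox.
have y_x' : y != m' x.
  by apply: contraNneq ny => ->; apply/attachedP; exists b1; rewrite // inE eqxx.
have y_x : y != x by rewrite eq_sym adj_neq.
have [omu um mmu mu] := out_mate sc ou; have k1mu := tri_mate sc ou k1u.
have [/andP[uC uk] /andP[wC wk] /andP[muC muk]] := And3 ou ow omu.
have [k12 k23 k31] := tri_adj sc; have [k1C k2C k3C] := tri_in sc.
have {}ny : ~~ attached [:: k1; u; m u] y.
  by apply: contra ny => /attachedP[k kb ky]; apply/attachedP; exists k; rewrite ?eqb.
pose l := [:: m' y; y; m' x; x; k1; u; m u].
have eql : perm_eq [:: m' y; y; m' x; x; b1; b2; b3] l.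
  by rewrite !perm_cons uniq_perm //; [case: scb|case: sc'].
have [pl sl ul] : [/\ perf m' (C :\: [set z in l]), {subset l <= C} & uniq l].
  have [pb sb ub] := tri_two_pairs scb ox oy y_x y_x'.
  split; last by rewrite -(perm_uniq eql).
    by move: pb; congr perf; apply/setP => t; rewrite !in_setD !in_set (perm_mem eql).
  by move=> t; rewrite -(perm_mem eql); apply: sb.
have b1b : b1 \in [:: k1; u; m u] by rewrite -eqb inE eqxx.
(* The pair of [t] ends the path: it is that of [w] if the triangle is entered at [k1], and [k2],
   [k3] if it is entered at [u] or [m u]. *)
have finish p t : perm_eq p (m' t :: t :: l) -> t \in C -> t \notin l ->
    sorted (@adj G) p -> False.
  move=> eqp tC tl sp; have [[mtC mtl mt _] pt] := perf_pair pl tC tl.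
  apply: (no_path (p := p)); rewrite ?(perm_size eqp) //.
  - rewrite /upath sp (perm_uniq eqp) cons_uniq in_cons negb_or mt mtl.
    by rewrite cons_uniq tl ul.
  - move=> r; rewrite (perm_mem eqp).
    by do 2 (case/predU1P=> [->//|]); apply: sl.
  - exists m'; move: pt; congr perf; apply/setP => r.
    by rewrite !in_setD !in_set (perm_mem eqp).
have finish2 c d : perm_eq [:: c; d] [:: u; m u] -> adj c d -> adj d k1 ->
    adj c x -> adj c (m' x) -> False.
  move=> eqcd cd dk1 cx cx'.
  have m'k2 : m' k2 = k3 by rewrite /m' /swap eqxx.
  have nck : ~~ adj k2 c.
    have : c \in [:: u; m u] by rewrite -(perm_mem eqcd) inE eqxx.
    by rewrite !inE => /orP[] /eqP->; [exact: (tri_excl sc ou)|exact: (tri_excl sc omu)].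
  apply: (finish [:: m' y; y; x; m' x; c; d; k1; k2; k3] k2) => //.
  - rewrite m'k2; apply/permP => P; have /permP/(_ P) := eqcd; rewrite /=; clear.
    by do 9 (set b := nat_of_bool _; move: {b}(b) => ?); lia.
  - have k2y : k2 != y.
      apply: contraNneq ny => <-; by rewrite /attached /= k12.
    have k2y' : k2 != m' y.
      have k3y : k3 != y.
        apply: contraNneq ny => <-; by rewrite /attached /= [adj k1 k3]adj_sym k31.
      apply: contraNneq k3y => eqk; have [_ _ mmy _] := out_mate scb oy.
      by rewrite -m'k2 eqk mmy.
    have k2x : k2 != x by apply: contraNneq nck => ->; rewrite adj_sym.
    have k2x' : k2 != m' x by apply: contraNneq nck => ->; rewrite adj_sym.
    rewrite /l; clear -k12 k2y k2y' k2x k2x' uk muk; neqs.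
  - rewrite /= [adj (m' y) y]adj_sym yy' [adj y x]adj_sym xy xx'.
    by rewrite [adj (m' x) c]adj_sym cx' cd dk1 k12 k23.
move: b1b; rewrite !inE => /or3P[]/eqP eqb1; rewrite eqb1 in b1x b1x'.
- apply: (finish [:: m' y; y; x; m' x; k1; m u; u; w; m' w] w) => //.
  + by apply/permP => P /=; clear; lia.
  + have wmu : w != m u.
      by apply: contraNneq nw => ->; rewrite /attached /= k1mu.
    have m'w : m' w = m w by apply: swap_out ow.
    have wy : w != y.
      by apply: contraNneq ny => <-; rewrite /attached /= uw orbT.
    have wy' : w != m' y.
      apply: contraNneq ny => eqw; have [_ _ mmy _] := out_mate scb oy.
      by rewrite -mmy -eqw m'w /attached /= (tri_chain sc ou k1u ow uw wmu) orbT.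
    have wx : w != x by apply: contraNneq nw => ->; rewrite /attached /= b1x.
    have wx' : w != m' x by apply: contraNneq nw => ->; rewrite /attached /= b1x'.
    by rewrite /l; clear -wx wx' wy wy' wmu uw wk; neqs.
  + have [_ wm _ _] := out_mate sc ow.
    rewrite /= [adj (m' y) y]adj_sym yy' [adj y x]adj_sym xy xx'.
    rewrite [adj (m' x) k1]adj_sym b1x' k1mu [adj (m u) u]adj_sym um uw.
    by rewrite /m' (swap_out m ow) wm.
- by apply: (finish2 u (m u)) => //; rewrite adj_sym.
- apply: (finish2 (m u) u) => //; rewrite 1?adj_sym //.
  by apply/permP => P /=; clear; lia.
Qed.

(** Keep the smallest class: delete [k1], [k2] and one vertex of each pair attached to these. Single
    vertices remain, and [k3] with [R k3], a piece of order [1 + #|R k3|]. *)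
Lemma hub_light m k1 k2 k3 : scycle m [:: k1; k2; k3] ->
  (forall z, outside [:: k1; k2; k3] z -> attached [:: k1; k2; k3] z) ->
  let R k := [set z | outside [:: k1; k2; k3] z && adj k z] in
  #|R k3| <= #|R k1| -> #|R k3| <= #|R k2| -> False.
Proof.
move=> sc all_att R le31 le32.
have sc2 := tri_rot sc; have sc3 := tri_rot sc2.
have o2 z : outside [:: k2; k3; k1] z = outside [:: k1; k2; k3] z.
  exact: outside_rot3.
have o3 z : outside [:: k3; k1; k2] z = outside [:: k1; k2; k3] z.
  by rewrite (outside_rot3 k2 k3 k1) o2.
have [k12 k23 k31] := tri_adj sc; have [k1C k2C k3C] := tri_in sc.
have closedR k z : k \in [:: k1; k2; k3] -> z \in R k -> m z \in R k.
  rewrite !inE => kb /andP[oz kz]; have [omz _ _ _] := out_mate sc oz.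
  rewrite omz; case/or3P: kb kz => /eqP-> kz.
  - exact: (tri_mate sc oz kz).
  - by apply: (tri_mate sc2 _ kz); rewrite o2.
  - by apply: (tri_mate sc3 _ kz); rewrite o3.
have ex12 z : z \in R k1 -> z \notin R k2.
  by rewrite !inE => /andP[oz kz]; rewrite oz (tri_excl sc oz kz).
have ex23 z : z \in R k2 -> z \notin R k3.
  by rewrite !inE => /andP[oz kz]; rewrite oz (tri_excl sc2 _ kz) // o2.
have ex31 z : z \in R k3 -> z \notin R k1.
  by rewrite !inE => /andP[oz kz]; rewrite oz (tri_excl sc3 _ kz) // o3.
have [_ uk sk _ pk] := sc; pose ks := [:: k1; k2; k3].
have RC : R k1 :|: R k2 :|: R k3 = C :\: [set z in ks].
  apply/setP => z; apply/idP/idP.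
    by rewrite !in_setU !in_set /outside -!andb_orr /= andbC => /and3P[_ -> ->].
  rewrite in_setD in_set => /andP[zk zC].
  have oz : outside ks z by rewrite /outside zC.
  have /attachedP[k] := all_att z oz.
  by rewrite !inE oz /= => /or3P[]/eqP-> ->; rewrite ?orbT.
have pR k : k \in ks -> perf m (R k).
  move=> kk; apply: perf_sub pk _ _; last by move=> z; apply: closedR.
  by apply/subsetP => z; rewrite !in_set => /andP[/andP[-> ->]].
have eR k : k \in ks -> ~~ odd #|R k| by move=> kk; apply: perf_card (pR k kk).
have dRk k z : z \in R k -> z \notin ks by rewrite in_set => /andP[/andP[]].
have d12 : [disjoint R k1 & R k2].
  by rewrite disjoints_subset; apply/subsetP => z /ex12; rewrite in_setC.
have cRC : #|R k1| + #|R k2| + #|R k3| + 3 = #|C|.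
  have sK : [set z in ks] \subset C by apply/subsetP => z; rewrite inE; apply: sk.
  have cK : #|[set z in ks]| = 3 by rewrite cardsE (card_uniqP uk).
  rewrite -(cardsID [set z in ks] C) (setIidPr sK) -RC cK.
  rewrite addnC; congr (_ + _); rewrite !cardsU (_ : (_ :|: _) :&: _ = set0).
    by rewrite (eqP (_ : R k1 :&: R k2 == set0)) ?setI_eq0 // cards0 !subn0.
  apply/setP => z; rewrite in_setI in_setU in_set0; apply/negP => /andP[].
  by case/orP => [zR|/ex23/negP//] /ex31; rewrite zR.
pose B := [set z in ks] :|: R k3.
apply: (@no_gain m B (R k1 :|: R k2) [set k1; k2]).
- by rewrite /B -setUA [R k3 :|: _]setUC RC setUC -{1}(setID C [set z in ks]) setUC
    (setIidPr _) //; apply/subsetP => z; rewrite inE; apply: sk.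
- rewrite disjoints_subset; apply/subsetP => z; rewrite in_setU in_set in_setC in_setU.
  case/orP => [zk|zR]; rewrite negb_or.
    by apply/andP; split; apply: contraL zk; apply: dRk.
  by rewrite (ex31 _ zR); apply: contraL zR; apply: ex23.
- move=> z; rewrite !in_setU => /orP[] zR.
    have [_ ? ?] := pR k1 (mem_head _ _) z zR.
    by split=> //; rewrite closedR // inE eqxx.
  have k2k : k2 \in ks by rewrite !inE eqxx orbT.
  by have [_ ? ?] := pR k2 k2k z zR; split=> //; rewrite (closedR k2) ?orbT.
- by rewrite subUset !sub1set !inE !eqxx ?orbT.
- move=> u z uR zC uz.
  have [zk|zk] := boolP (z \in ks).
    left; move: zk; rewrite !inE => /or3P[->|->|/eqP eqz]; rewrite ?orbT //.
    have uR3 : u \in R k3.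
      rewrite in_set; apply/andP; split; last by rewrite -eqz adj_sym.
      by move: uR; rewrite in_setU !in_set => /orP[] /andP[].
    by move: uR; rewrite in_setU (negPf (ex31 _ uR3)) /= => /ex23; rewrite uR3.
  right; have oz : outside ks z by rewrite /outside zC.
  have zR : z \in R k1 :|: R k2 :|: R k3 by rewrite RC in_setD in_set zk.
  have ou : outside ks u by move: uR; rewrite in_setU !in_set => /orP[] /andP[].
  have pair k b c : scycle m [:: k; b; c] -> outside [:: k; b; c] =1 outside ks ->
      adj k u -> adj k z -> z = m u.
    by move=> sck oE ku kz; apply: (tri_pair sck) uz; rewrite ?oE.
  have cross k b c : scycle m [:: k; b; c] -> outside [:: k; b; c] =1 outside ks ->
      (adj k u && adj b z) || (adj k z && adj b u) -> z = m u.
    move=> sck oE; case/orP => /andP[kx bx].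
      by have := tri_cross sck _ _ kx bx; rewrite !oE uz => /(_ ou oz).
    by have := tri_cross sck _ _ kx bx; rewrite !oE adj_sym uz => /(_ oz ou).
  have {}zR : [|| adj k1 z, adj k2 z | adj k3 z].
    by move: zR; rewrite !in_setU !in_set -orbA => /or3P[]/andP[_ ->]; rewrite ?orbT.
  have {}uR : adj k1 u || adj k2 u.
    by move: uR; rewrite in_setU !in_set => /orP[]/andP[_ ->]; rewrite ?orbT.
  case/orP: uR => ku; case/or3P: zR => kz.
  + exact: (pair _ _ _ sc).
  + by apply: (cross _ _ _ sc) => //; rewrite ku kz.
  + by apply: (cross _ _ _ sc3 o3) => //; rewrite ku kz orbT.
  + by apply: (cross _ _ _ sc) => //; rewrite ku kz orbT.
  + exact: (pair _ _ _ sc2 o2).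
  + by apply: (cross _ _ _ sc2 o2) => //; rewrite ku kz.
- have c2 : #|[set k1; k2]| = 2 by rewrite cards2 adj_neq.
  have cU : #|R k1 :|: R k2| = #|R k1| + #|R k2|.
    by rewrite cardsU (eqP (_ : R k1 :&: R k2 == set0)) ?setI_eq0 // cards0 subn0.
  have : wt (1 + #|R k3|) <= weight (B :\: [set k1; k2]).
    apply: leq_trans (weight_ge_wt _).
    rewrite (_ : B :\: _ = k3 |: R k3).
      by rewrite cardsU1 (contraL (@dRk k3 k3)) // !inE eqxx !orbT.
    apply/setP => z; rewrite in_setD in_set2 in_setU1 /B in_setU in_set.
    have [->|zk1] := eqVneq z k1.
      rewrite /= (negPf (contraL (@dRk k3 k1) _)) ?inE ?eqxx // orbF.
      by apply/esym/negbTE; rewrite eq_sym adj_neq.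
    have [->|zk2] := eqVneq z k2.
      rewrite /= (negPf (contraL (@dRk k3 k2) _)) ?inE ?eqxx ?orbT // orbF.
      by apply/esym/negbTE; rewrite adj_neq.
    by rewrite !inE (negPf zk1) (negPf zk2).
  rewrite c2 cU.
  have [e1 e2 e3] : [/\ ~~ odd #|R k1|, ~~ odd #|R k2| & ~~ odd #|R k3| ].
    by split; apply: eR; rewrite !inE eqxx ?orbT.
  move: cRC card_ge9 e1 e2 e3 le31 le32.
  move: #|R k1| #|R k2| #|R k3| #|C| (weight _) => r1 r2 r3 c w; clear.
  move=> cE c9 e1 e2 e3 le31 le32.
  (* To be met is 10 <= 2 wt(1 + r3) + r1 + r2, where the even numbers [r1], [r2], [r3] add up to at
     least 6. From 5 on, minimality of [r3] suffices; for [r3] equal to 0, 2, 4 the weight is 3, 3,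
     2. *)
  have [r5|r5] := leqP 5 r3; first by lia.
  by case: r3 r5 e3 le31 le32 cE => [|[|[|[|[|?]]]]] //= _ _; rewrite /wt /=; lia.
Qed.

Lemma critical_absurd : False.
Proof.
have [m [k1 [k2 [k3 [sc att]]]]] := exists_hub.
have sc2 := tri_rot sc; have sc3 := tri_rot sc2.
have o2 z : outside [:: k2; k3; k1] z = outside [:: k1; k2; k3] z.
  exact: outside_rot3.
have o3 z : outside [:: k3; k1; k2] z = outside [:: k1; k2; k3] z.
  by rewrite (outside_rot3 k2 k3 k1) o2.
have h1 := hub_light sc att; have h2 := hub_light sc2; have h3 := hub_light sc3.
pose R k := [set z | outside [:: k1; k2; k3] z && adj k z].
have R2 k : [set z | outside [:: k2; k3; k1] z && adj k z] = R k.
  by apply/setP => z; rewrite !in_set o2.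
have R3 k : [set z | outside [:: k3; k1; k2] z && adj k z] = R k.
  by apply/setP => z; rewrite !in_set o3.
have {}h2 : #|R k1| <= #|R k2| -> #|R k1| <= #|R k3| -> False.
  by rewrite -!R2; apply: h2 => z; rewrite o2 attached_rot; apply: att.
have {}h3 : #|R k2| <= #|R k3| -> #|R k2| <= #|R k1| -> False.
  rewrite -!R3; apply: h3 => z.
  by rewrite o3 (attached_rot k2 k3 k1) (attached_rot k1 k2 k3); apply: att.
have {}h1 : #|R k3| <= #|R k1| -> #|R k3| <= #|R k2| -> False := h1.
move: #|R k1| #|R k2| #|R k3| h1 h2 h3 => r1 r2 r3; clear; lia.
Qed.

End Triangles.

End Critical.

(** * The surplus of a factor-critical component *)

Lemma critical_tiled (G : sgraph) (C : {set G}) : fcrit C -> C != set0 ->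
  (forall X : {set G}, X \subset C -> weight (C :\: X) <= 2 * #|X|) -> tiled C.
Proof. by move=> fC C0 wC; apply: NNPP; apply: critical_absurd. Qed.

Lemma sat_leq (G : sgraph) (D : {set G}) v m n :
  m <= n -> sat D v n -> sat D v m.
Proof. by move=> lemn [p [? ? ? len ?]]; exists p; split=> //; apply: leq_trans len. Qed.

(* In a windmill with three blades [X] must contain the centre, the only vertex from
   which no saturated path of order 5 starts. *)
Lemma fcrit_classify (G : sgraph) (D : {set G}) : fcrit D -> D != set0 ->
  exists (X : {set G}) t, [/\ t <= 2, X \subset D, 2 * #|X| + t <= weight (D :\: X),
    t = 0 -> tiled D
    & t < 2 -> (forall v, v \in D -> sat D v 3) /\
               (forall v, v \in D :\: X -> sat D v 5)].
Proof.
move=> fD D0; have oD := fcrit_odd fD D0.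
have [[v vD nv]|all5] := classic (exists2 v, v \in D & ~ sat D v 5); last first.
  have sat5 v : v \in D -> sat D v 5.
    by move=> vD; apply: NNPP => nv; apply: all5; exists v.
  have sat3 v : v \in D -> sat D v 3 by move/sat5; apply: sat_leq.
  have [tD|ntD] := classic (tiled D).
    exists set0, 0; split=> //; rewrite ?sub0set ?cards0 // => _; split=> // v.
    by rewrite setD0; apply: sat5.
  have [X sX wX] : exists2 X : {set G}, X \subset D & 2 * #|X| < weight (D :\: X).
    apply: NNPP => nX; apply: ntD; apply: critical_tiled => // X sX.
    by rewrite leqNgt; apply/negP => ltX; apply: nX; exists X.
  exists X, 1; split=> //; first by rewrite addn1.
  by move=> _; split=> // v; rewrite in_setD => /andP[_]; apply: sat5.
have [m pm] := fD v vD; have wm := windmill fD vD nv pm.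
(* Orders 1, 3 and 5 already weigh at least 2 with nothing deleted. *)
have [le5|gt5] := leqP #|D| 5.
  exists set0, 2; split=> //; rewrite ?sub0set // cards0 setD0.
  apply: leq_trans (weight_ge_wt _).
  by move: #|D| oD le5; do 6?case=> //.
have cD : #|D| = #|D :\ v|.+1 by rewrite (cardsD1 v) vD.
have eqD : D = [set v] :|: (D :\ v) by rewrite setD1K.
(* Each blade of the windmill adds 3 - 2, the centre costs 2. With ([#|D|] - 1)/2 blades the surplus
   reaches 2 from order 9 on, and 1 at order 7. *)
have gain g : g * 2 + 5 <= #|D| ->
    exists X : {set G}, [/\ X \subset D, v \in X & 2 * #|X| + g <= weight (D :\: X)].
  move=> leg; have [||||X []] := pairs_gain (B := [set v]) (Y := [set v]) (g := g) _ pm.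
  - by rewrite disjoints_subset sub1set !inE eqxx.
  - by [].
  - rewrite -eqD => u z uR zD uz; have [_ /(_ z zD uz)[->|->]] := wm u uR.
      by left; rewrite inE.
    by right.
  - by move: leg; rewrite cards1 cD; lia.
  by rewrite -eqD sub1set => ? ? ?; exists X.
have [le9|lt9] := leqP 9 #|D|.
  by have [X [sX _ wX]] := gain 2 le9; exists X, 2.
have [|X [sX vX wX]] := gain 1; first by move: oD gt5; move: #|D| => d; clear; lia.
exists X, 1; split=> // _; split=> w wD.
  by apply: sat3 => //; apply: leq_trans gt5.
(* A vertex [w] outside [X] with no such path would be a second centre. Then [v] would see only [w]
   and [m' v], although it sees all of [D :\ v]. *)
apply: NNPP => nw; have {wD}[wnX wD] : w \notin X /\ w \in D by apply/andP; rewrite -in_setD.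
have [m' pm'] := fD w wD; have vw : v != w by apply: contraNneq wnX => <-.
have [|_ nbr] := windmill fD wD nw pm' (u := v); first by rewrite !inE vw.
have : D :\ v \subset [set w; m' v].
  apply/subsetP => z zD; have [vz _] := wm z zD.
  have [|->|->] := nbr z _ vz; rewrite ?inE ?eqxx ?orbT //.
  by move: zD; rewrite inE => /andP[].
move/subset_leq_card; rewrite cards2 => le2; move: gt5; rewrite cD.
by move: le2; case: (w != m' v); move: #|_| => d; clear; lia.
Qed.

(** * Hall's theorem and barriers *)

Section Hall.
Variables T1 T2 : finType.

Definition image_rel (r : T1 -> T2 -> bool) (X : {set T1}) :=
  [set y | [exists x in X, r x y]].

(** Halmos-Vaughan induction: split [L] along a nonempty proper subset for which equality holds; if
    there is none, assign any admissible value to one element, as the other sets can spare it. [y0]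
    supplies values when [L] is empty. *)
Theorem hall (y0 : T2) (r : T1 -> T2 -> bool) (L : {set T1}) :
  (forall X : {set T1}, X \subset L -> #|X| <= #|image_rel r X|) ->
  exists2 f : T1 -> T2, {in L &, injective f} & forall x, x \in L -> r x (f x).
Proof.
have [n] := ubnP #|L|; elim: n L r => // n IHn L r leLn hallL.
have [->|[x0 x0L]] := set_0Vmem L.
  by exists (fun=> y0) => [x y|x]; rewrite inE.
have [[X [sX X0 tX]]|ntight] := classic (exists X : {set T1},
    [/\ X \proper L, X != set0 & #|image_rel r X| = #|X|]).
  have sXL := proper_sub sX.
  have [||f fi fr] := IHn X r.
  - by have := proper_card sX; lia.
  - by move=> Y sY; apply: hallL; apply: subset_trans sXL.
  have [||g gi gr] := IHn (L :\: X) (fun x y => r x y && (y \notin image_rel r X)).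
  - rewrite cardsD (setIidPr sXL).
    by have := subset_leq_card sXL; move: X0 leLn; rewrite -card_gt0; lia.
  - move=> Y sY; have dXY : [disjoint X & Y].
      by rewrite disjoint_sym; have := sY; rewrite subsetD => /andP[].
    have := hallL (X :|: Y).
    rewrite subUset sXL (subset_trans sY (subsetDl _ _)) => /(_ isT).
    rewrite cardsU (eqP (_ : X :&: Y == set0)) ?setI_eq0 // cards0 subn0 -tX.
    set Z := image_rel _ Y.
    have sZ : image_rel r (X :|: Y) \subset image_rel r X :|: Z.
      apply/subsetP => y; rewrite !inE => /exists_inP[x]; rewrite inE.
      have [//|yX] := boolP [exists x in X, r x y].
      case/orP => xXY xy; first by case/exists_inP: yX; exists x.
      by apply/exists_inP; exists x; rewrite ?xy ?inE.
    move=> le1; have := leq_trans le1 (leq_trans (subset_leq_card sZ) (leq_card_setU _ _)).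
    by rewrite leq_add2l.
  exists (fun x => if x \in X then f x else g x) => [x y xL yL|x xL]; last first.
    case: ifPn => [/fr//|xX].
    by have /andP[] : r x (g x) && (g x \notin image_rel r X) by apply: gr; rewrite in_setD xX.
  have gX z : z \in L -> z \notin X -> g z \notin image_rel r X.
    move=> zL zX.
    by have /andP[] : r z (g z) && (g z \notin image_rel r X) by apply: gr; rewrite in_setD zX.
  have fX z : z \in X -> f z \in image_rel r X.
    by move=> zX; rewrite inE; apply/exists_inP; exists z; rewrite ?fr.
  case: ifPn => xX; case: ifPn => yX.
  - exact: fi.
  - by move=> eqf; have := gX y yL yX; rewrite -eqf fX.
  - by move=> eqf; have := gX x xL xX; rewrite eqf fX.
  - by apply: gi; rewrite in_setD ?xX ?yX.
have [y1 x0y1] : exists y, r x0 y.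
  have := hallL [set x0]; rewrite sub1set cards1 => /(_ x0L).
  rewrite card_gt0 => /set0Pn[y]; rewrite inE => /exists_inP[x].
  by rewrite inE => /eqP-> ?; exists y.
have [||f fi fr] := IHn (L :\ x0) (fun x y => r x y && (y != y1)).
- by rewrite (cardsD1 x0) x0L in leLn.
- move=> Y sY; have [->|Y0] := eqVneq Y set0; first by rewrite cards0.
  have sYL : Y \proper L.
    apply/properP; split; first exact: subset_trans sY (subsetDl _ _).
    by exists x0 => //; apply/negP => /(subsetP sY); rewrite !inE eqxx.
  have ltY : #|Y| < #|image_rel r Y|.
    rewrite ltn_neqAle hallL ?proper_sub // andbT eq_sym.
    by apply/negP => /eqP eqY; apply: ntight; exists Y.
  rewrite -ltnS; apply: leq_trans ltY _; rewrite (cardsD1 y1) -add1n.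
  apply: leq_add; first by case: (_ \in _).
  apply: subset_leq_card; apply/subsetP => y; rewrite !inE => /andP[yy1].
  by case/exists_inP => x xY xy; apply/exists_inP; exists x; rewrite // xy.
exists (fun x => if x == x0 then y1 else f x) => [x y xL yL|x xL].
  have fn z : z \in L -> z != x0 -> f z != y1.
    move=> zL zx.
    by have /andP[] : r z (f z) && (f z != y1) by apply: fr; rewrite in_setD1 zx.
  case: eqVneq => [->|xx0]; case: eqVneq => [->|yx0] //.
  - by move=> eqy; have := fn y yL yx0; rewrite eqy eqxx.
  - by move=> eqx; have := fn x xL xx0; rewrite eqx eqxx.
  - by apply: fi; rewrite !inE ?xx0 ?yx0.
case: eqVneq => [->//|xx0].
by have /andP[] : r x (f x) && (f x != y1) by apply: fr; rewrite in_setD1 xx0.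
Qed.

End Hall.

Lemma prop_argmax (T : finType) (Q : T -> Prop) (mu : T -> nat) t0 : Q t0 ->
  exists2 t, Q t & forall t', Q t' -> mu t' <= mu t.
Proof.
move=> Qt0; have [q qP] : exists q : T -> bool, forall t, q t <-> Q t.
  apply: (fin_all_exists (P := fun t (b : bool) => b <-> Q t)) => t.
  by have [Qt|nQt] := classic (Q t); [exists true|exists false].
have qt0 : q t0 by apply/qP.
by case: (arg_maxnP mu qt0) => t /qP Qt max; exists t => // t' /qP; apply: max.
Qed.

Section Barrier.
Variable G : sgraph.
Implicit Types (A B C D E S X : {set G}) (P : {set {set G}}).

(** The members are disjoint unions of components of [A :\: S]. Closure under adjacency stands in
    for connectedness, which would have to be proved anew at each change of the family. *)
Definition blocks A S P := [/\ S \subset A,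
  forall D, D \in P -> D \subset A :\: S,
  forall D E x, D \in P -> E \in P -> x \in D -> x \in E -> D = E
  & forall D x y, D \in P -> x \in D -> y \in A :\: S -> adj x y -> y \in D].

Definition star (f : G -> {set G}) S := S :|: \bigcup_(s in S) f s.

(** Each [s] is matched with a neighbour in its own block, and the rest of this block by
    factor-criticality. *)
Lemma matchable_star (f : G -> {set G}) S :
  (forall s, s \in S -> fcrit (f s) /\ exists2 v, v \in f s & adj s v) ->
  (forall s t x, s \in S -> t \in S -> x \in f s -> x \in f t -> s = t) ->
  (forall s, s \in S -> [disjoint f s & S]) ->
  matchable (star f S).
Proof.
have [n] := ubnP #|S|; elim: n S => // n IHn S leSn fS fI dS.
have [->|[s sS]] := set_0Vmem S; first by rewrite /star big_set0 setU0; apply: matchable0.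
have [fs [v vs sv]] := fS s sS.
have -> : star f S = ([set s; v] :|: (f s :\ v)) :|: star f (S :\ s).
  rewrite /star (big_setD1 s) //= -{1}(setD1K sS) -{1}(setD1K vs).
  by apply/setP => x; rewrite !inE; btauto.
have Ss t : t \in S :\ s -> t \in S by rewrite inE => /andP[].
have fsS x : x \in f s -> x \notin star f (S :\ s).
  move=> xs; rewrite inE negb_or; apply/andP; split.
    by apply: contraTN xs => /Ss xS; rewrite (disjointFl (dS s sS)).
  apply/bigcupP => -[t tS xt]; have := fI s t x sS (Ss t tS) xs xt.
  by move=> eqst; rewrite -eqst !inE eqxx in tS.
apply: matchableU.
- rewrite disjoints_subset !subUset !sub1set !in_setC (fsS v vs) andbT.
  apply/andP; split; last first.
    by apply/subsetP => x; rewrite in_setD1 in_setC => /andP[_ /fsS].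
  rewrite inE negb_or !inE eqxx /=; apply/bigcupP => -[t tS st].
  by have := disjointFr (dS t (Ss t tS)) st; rewrite sS.
- apply: matchableU (matchable2 sv) (fs v vs).
  rewrite disjoints_subset subUset !sub1set !inE eqxx /= negb_and.
  by rewrite (disjointFl (dS s sS) sS) orbT.
apply: IHn => [|t /Ss|t u x /Ss tS /Ss|t tS]; [|exact: fS|exact: fI|].
  by rewrite (cardsD1 s) sS in leSn.
have := dS t (Ss t tS); rewrite !disjoints_subset => /subset_trans; apply.
by rewrite setCS subsetDl.
Qed.

Lemma odd_cover P : (forall D E x, D \in P -> E \in P -> x \in D -> x \in E -> D = E) ->
  (forall D, D \in P -> odd #|D|) -> odd #|cover P| = odd #|P|.
Proof.
move=> injP oddP; have tP : trivIset P.
  apply/trivIsetP => D E DP EP nDE; rewrite -setI_eq0; apply/set0Pn => -[x].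
  by rewrite inE => /andP[xD xE]; case/eqP: nDE; apply: injP xD xE.
rewrite -(eqP tP) -sum1_card.
by elim/big_rec2: _ => // D a b DP eqab; rewrite !oddD eqab oddP.
Qed.

(** Take odd blocks with [#|P| - #|S|] maximal, and then [#|S|] maximal. Uncovered vertices, a block
    that is not factor-critical, or a failure of Hall's condition would each permit a better choice.
    The second case splits the block by a barrier of [D :\ x], whence the induction on [#|A|]. *)
Lemma barrier A : exists S P (f : G -> {set G}),
  [/\ blocks A S P, A :\: S \subset cover P,
      forall D, D \in P -> fcrit D /\ D != set0,
      {in S &, injective f}
    & forall s, s \in S -> f s \in P /\ exists2 v, v \in f s & adj s v].
Proof.
have [n] := ubnP #|A|; elim: n A => // n IHn A leAn.
pose Q (t : {set G} * {set {set G}}) :=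
  blocks A t.1 t.2 /\ forall D, D \in t.2 -> odd #|D|.
(* [mu] encodes the lexicographic order on [(#|P| - #|S|, #|S|)]. *)
pose mu (t : {set G} * {set {set G}}) :=
  (#|t.2| + #|A :\: t.1|) * #|A|.+1 + #|t.1|.
have Q0 : Q (set0, set0).
  by split; [split=> [|D|D E x|D x y]; rewrite ?sub0set ?inE|move=> D; rewrite inE].
have [[S P] /= [bSP oP] maxSP] := prop_argmax mu Q0.
rewrite /= in bSP oP.
have {maxSP} opt S' P' : blocks A S' P' -> (forall D, D \in P' -> odd #|D|) ->
    #|P'| + #|S| <= #|P| + #|S'| /\
    (#|P'| + #|S| = #|P| + #|S'| -> #|S'| <= #|S|).
  move=> b' o'; have /= := maxSP (S', P') (conj b' o'); rewrite /mu /=.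
  have [sS _ _ _] := bSP; have [sS' _ _ _] := b'.
  rewrite !cardsD (setIidPr sS) (setIidPr sS').
  have := subset_leq_card sS; have := subset_leq_card sS'.
  move: #|S| #|S'| #|A| #|P| #|P'|; clear => s s' a p p' les' les le1.
  by split; nia.
have [sS sPA injP clP] := bSP.
have coverP D x : D \in P -> x \in D -> x \in A /\ x \notin S.
  by move=> DP /(subsetP (sPA D DP)); rewrite in_setD => /andP[].
have covP : A :\: S \subset cover P.
  rewrite -setD_eq0; apply/negPn/negP => /set0Pn[x]; set R := A :\: S :\: cover P => xR.
  have RP D y : D \in P -> y \in D -> y \notin R.
    by move=> DP yD; rewrite /R in_setD negb_and negbK; apply/orP; left; apply/bigcupP; exists D.
  have clR y z : y \in R -> z \in A :\: S -> adj y z -> z \in R.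
    rewrite {1}/R in_setD => /andP[yP yAS] zAS yz; rewrite /R in_setD zAS andbT.
    apply: contra yP => /bigcupP[D DP zD]; apply/bigcupP; exists D => //.
    by apply: clP zD yAS _ => //; rewrite adj_sym.
  have sRA : R \subset A :\: S by apply: subsetDl.
  have addR (T : {set G}) : T \subset R -> T != set0 -> T \notin P /\ 
      (forall D y, D \in P -> y \in D -> y \notin T).
    move=> sT /set0Pn[y yT]; split=> [|D z DP zD].
      by apply/negP => TP; have := RP T y TP yT; rewrite (subsetP sT).
    by apply: contra (RP D z DP zD); apply: (subsetP sT).
  have [oR|eR] := boolP (odd #|R|).
    have [nRP RP'] : R \notin P /\ (forall D y, D \in P -> y \in D -> y \notin R).
      by apply: addR => //; apply/set0Pn; exists x.
    have [||le1 _] := opt S (R |: P).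
    - split=> // [D /setU1P[->|/sPA]//|D E y /setU1P[->|DP] /setU1P[->|EP] yD yE|].
      + by [].
      + by have := RP E y EP yE; rewrite yD.
      + by have := RP D y DP yD; rewrite yE.
      + exact: injP yD yE.
      + by move=> D y z /setU1P[->|DP]; [apply: clR|apply: clP].
    - by move=> D /setU1P[->|/oP].
    by move: le1; rewrite cardsU1 nRP /=; lia.
  (* Here [R] is even: moving [x] into the barrier makes [R :\ x] an odd block. The difference is
     unchanged, but the barrier has grown. *)
  have xA : x \in A :\: S := subsetP sRA x xR.
  have oRx : odd #|R :\ x| by move: eR; rewrite (cardsD1 x) xR /= negbK.
  have [|nRP RP'] := addR (R :\ x) (subsetDl _ _).
    by apply: contraTneq oRx => ->; rewrite cards0.
  have xS : x \notin S by move: xA; rewrite inE => /andP[].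
  have inAS y : y \in A :\: (x |: S) -> y \in A :\: S /\ y != x.
    by rewrite !inE negb_or -andbA => /and3P[-> -> ->].
  have [||le1 le2] := opt (x |: S) (R :\ x |: P).
  - split.
    + by rewrite subUset sub1set sS andbT; move: xA; rewrite inE => /andP[].
    + have xP D : D \in P -> D \subset A :\: (x |: S).
        move=> DP; apply/subsetP => y yD; have [yA yS] := coverP D y DP yD.
        rewrite !inE yA negb_or yS !andbT; apply: contraTneq xR => <-.
        exact: RP yD.
      move=> D /setU1P[->|/xP//]; apply/subsetP => y; rewrite in_setD1 => /andP[yx yR].
      by have := subsetP sRA y yR; rewrite !inE negb_or yx.
    + move=> D E y /setU1P[->|DP] /setU1P[->|EP] yD yE //.
      * by have := RP' E y EP yE; rewrite yD.
      * by have := RP' D y DP yD; rewrite yE.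
      * exact: injP yD yE.
    + move=> D y z /setU1P[->|DP] yD /inAS[zAS zx] yz; last exact: clP yD zAS yz.
      by rewrite in_setD1 zx; apply: clR yz => //; move: yD; rewrite in_setD1 => /andP[].
  - by move=> D /setU1P[->|/oP].
  by move: le1 le2; rewrite !cardsU1 nRP xS /=; lia.
have critP D : D \in P -> fcrit D.
  move=> DP x xD; apply: NNPP => nm.
  have sDA : D \subset A by apply: subset_trans (sPA D DP) (subsetDl _ _).
  have [|S1 [P1 [f1 [[sS1 sP1 inj1 cl1] cov1 crit1 f1I f1P]]]] := IHn (D :\ x).
    have := subset_leq_card sDA; rewrite (cardsD1 x D) xD; move: leAn; clear; lia.
  have sf1 : f1 @: S1 \subset P1.
    by apply/subsetP => E /imsetP[s sS1' ->]; have [] := f1P s sS1'.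
  have le11 : #|S1| <= #|P1| by rewrite -(card_in_imset f1I) subset_leq_card.
  have o1 E : E \in P1 -> odd #|E| by move=> EP1; have [? ?] := crit1 E EP1; apply: fcrit_odd.
  have cover1 : cover P1 = D :\ x :\: S1.
    by apply/eqP; rewrite eqEsubset cov1 andbT; apply/bigcupsP => E; apply: sP1.
  (* The even number [#|D :\ x|] is [#|S1|] plus the odd orders of the blocks in [P1]. Without a
     perfect matching, [#|P1|] thus exceeds [#|S1|] by at least 2, which pays for losing [D] and for
     adding [x] to the barrier. *)
  have par : odd #|P1| = odd #|S1|.
    have := odd_cover inj1 o1; rewrite cover1 cardsD (setIidPr sS1) => <-.
    have := oP D DP; rewrite (cardsD1 x) xD /= => eD.
    have := subset_leq_card sS1; move: eD; clear; lia.
  have [eq11|ne11] := eqVneq #|S1| #|P1|.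
    case: nm; have <- : star f1 S1 = D :\ x; last first.
      apply: matchable_star => [s sS1'|s t y sS1' tS1 ys yt|s sS1'].
      - by have [fP ?] := f1P s sS1'; have [] := crit1 _ fP.
      - apply: f1I => //; apply: inj1 ys yt.
          by have [] := f1P s sS1'.
        by have [] := f1P t tS1.
      - have [fP _] := f1P s sS1'; rewrite disjoints_subset.
        by apply: subset_trans (sP1 _ fP) _; rewrite setDE subsetIr.
    rewrite /star -[RHS](setID _ S1) (setIidPr sS1) -cover1; congr (_ :|: _).
    have -> : P1 = f1 @: S1.
      by apply/esym/eqP; rewrite eqEcard sf1 (card_in_imset f1I) eq11 leqnn.
    by rewrite cover_imset.
  have S1D y : y \in S1 -> y \in D /\ y != x.
    by move/(subsetP sS1); rewrite in_setD1 => /andP[yx yD]; split.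
  have P1D E y : E \in P1 -> y \in E -> [/\ y \in D, y != x & y \notin S1].
    move=> EP1 yE; have := subsetP (sP1 E EP1) y yE.
    by rewrite !inE => /and3P[].
  pose S' := x |: (S :|: S1); pose P' := (P :\ D) :|: P1.
  have inS' y : (y \notin S') = [&& y != x, y \notin S & y \notin S1].
    by rewrite /S' !inE !negb_or.
  have xA := subsetP sDA x xD.
  have PD E y : E \in P :\ D -> y \in E -> y \notin D.
    rewrite in_setD1 => /andP[nED EP] yE; apply: contra nED => yD.
    by rewrite (injP E D y EP DP yE yD).
  have PP E : E \in P :\ D -> E \in P by rewrite inE => /andP[].
  have [||le1 le2] := opt S' P'.
  - split.
    + rewrite !subUset sub1set xA sS /=; apply/subsetP => y /S1D[yD _].
      exact: (subsetP sDA).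
    + move=> E /setUP[EP|EP1]; apply/subsetP => y yE; rewrite in_setD inS'.
        have [yA yS] := coverP E y (PP E EP) yE; have yD := PD E y EP yE.
        rewrite yA yS andbT; apply/and3P; split=> //.
          by apply: contraNneq yD => ->.
        by apply: contra yD => /S1D[].
      have [yD yx yS1] := P1D E y EP1 yE; have [yA yS] := coverP D y DP yD.
      by rewrite yA yx yS yS1.
    + move=> E F y /setUP[EP|EP1] /setUP[FP|FP1] yE yF.
      * by apply: injP yE yF; apply: PP.
      * by have [yD _ _] := P1D F y FP1 yF; have := PD E y EP yE; rewrite yD.
      * by have [yD _ _] := P1D E y EP1 yE; have := PD F y FP yF; rewrite yD.
      * exact: inj1 yE yF.
    + move=> E y z /setUP[EP|EP1] yE; rewrite in_setD inS' => /andP[/and3P[zx zS zS1] zA] yz.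
        by apply: clP yE _ yz; [apply: PP|rewrite in_setD zS].
      have [yD yx yS1] := P1D E y EP1 yE.
      have zD : z \in D by apply: clP yD _ yz => //; rewrite in_setD zS.
      by apply: cl1 yE _ yz => //; rewrite !inE zS1 zx.
  - by move=> E /setUP[/PP/oP|/o1].
  have cS' : #|S'| = (#|S| + #|S1|).+1.
    rewrite cardsU1 !inE (negPf (proj2 (coverP D x DP xD))) /=.
    have -> : x \notin S1 by apply/negP => /S1D[_]; rewrite eqxx.
    rewrite cardsU (_ : S :&: S1 = set0) ?cards0 ?subn0 //.
    apply/setP => y; rewrite in_setI in_set0; apply/negP => /andP[yS /S1D[yD _]].
    by have [_] := coverP D y DP yD; rewrite yS.
  have cP' : #|P'| = #|P| + #|P1| - 1.
    rewrite cardsU (_ : _ :&: P1 = set0) ?cards0 ?subn0 ?(cardsD1 D P) ?DP.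
      by rewrite add1n addSn subn1.
    apply/setP => E; rewrite in_setI in_set0; apply/negP => /andP[EP EP1].
    have [_ /set0Pn[y yE]] := crit1 E EP1; have [yD _ _] := P1D E y EP1 yE.
    by have := PD E y EP yE; rewrite yD.
  have P_gt0 : 0 < #|P| by rewrite card_gt0; apply/set0Pn; exists D.
  move: le1 le2; rewrite cS' cP'; move: P_gt0 ne11 le11 par.
  by move: #|P| #|P1| #|S| #|S1|; clear => p p1 s s1; lia.
have nonempty D : D \in P -> D != set0.
  by move/oP; apply: contraTneq => ->; rewrite cards0.
pose r s D := (D \in P) && [exists v in D, adj s v].
(* If [T] had too few neighbouring blocks, taking [T] out of the barrier and dropping these blocks
   would increase the difference. *)
have [T sT|f fI fr] := hall (set0 : {set G}) (r := r) (L := S).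
  have [|E EP|le1 _] := opt (S :\: T) (P :\: image_rel r T).
  - split.
    + by apply: subset_trans sS; apply: subsetDl.
    + move=> D; rewrite in_setD => /andP[_ DP]; apply: subset_trans (sPA D DP) _.
      exact: setDS (subsetDl _ _).
    + move=> D E x; rewrite !in_setD => /andP[_ DP] /andP[_ EP]; exact: injP.
    + move=> D x y /setDP[DP nD] xD /setDP[yA yST] xy.
      have [yS|] := boolP (y \in S); last first.
        by move=> yS; apply: clP xD _ xy => //; rewrite in_setD yS.
      have yT : y \in T by move: yST; rewrite in_setD yS andbT negbK.
      case/negP: nD; rewrite inE; apply/exists_inP; exists y; rewrite // /r DP.
      by apply/exists_inP; exists x; rewrite // adj_sym.
  - by apply: oP; case/setDP: EP.
  have sr : image_rel r T \subset P.
    by apply/subsetP => D; rewrite inE => /exists_inP[s _ /andP[]].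
  move: le1; rewrite !cardsD (setIidPr sT) (setIidPr sr).
  have := subset_leq_card sT; have := subset_leq_card sr.
  by move: #|image_rel r T| #|P| #|S| #|T|; clear => a b c d; lia.
exists S, P, f; split=> // [D DP|s sS']; first by split; [apply: critP|apply: nonempty].
by have /andP[fP /exists_inP] := fr s sS'.
Qed.

End Barrier.

(** * Distribution of the slots *)

(* As in the Cantor-Bernstein theorem, [h] is [k] on the chains that start outside the
   range of [g], and the inverse of [g] elsewhere. *)
Lemma injection_merge (T1 T2 : finType) (U : {set T1}) (R : {set T2})
    (g : T1 -> T2) (k : T2 -> T1) :
  {in U &, injective g} -> {in R &, injective k} ->
  (forall u, u \in U -> g u \in R) ->
  exists h : T2 -> T1, [/\ {in R &, injective h}, U \subset h @: R
    & forall y, y \in R -> h y = k y \/ (h y \in U /\ g (h y) = y)].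
Proof.
move=> gI kI gR.
pose step := [rel y z | (k y \in U) && (g (k y) == z)].
pose Z := [set y in R | [exists y0 in R :\: g @: U, connect step y0 y]].
have stepZ y : y \in Z -> k y \in U -> g (k y) \in Z.
  rewrite !inE => /andP[yR /exists_inP[y0 y0R c0]] kU; rewrite gR //=.
  apply/exists_inP; exists y0 => //; apply: connect_trans c0 (connect1 _).
  by rewrite /step /= kU eqxx.
have ZI u : u \in U -> g u \in Z -> exists2 y, y \in Z & u = k y.
  move=> uU; rewrite inE => /andP[guR /exists_inP[y0]].
  rewrite in_setD => /andP[ny0 y0R] /connectP[p].
  case/lastP: p => [_ /= eqg|p z]; first by rewrite -eqg imset_f in ny0.
  rewrite rcons_path last_rcons => /andP[pp stz] eqz.
  move: stz; rewrite -eqz /step /= => /andP[kU /eqP eqg].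
  exists (last y0 p); last by apply: gI.
  have lR : last y0 p \in R.
    elim/last_ind: p pp {kU eqg} => [//|p x _].
    by rewrite rcons_path last_rcons => /andP[_ /andP[kU /eqP<-]]; apply: gR.
  by rewrite inE lR; apply/exists_inP; exists y0; rewrite ?in_setD ?ny0 //;
    apply/connectP; exists p.
pose inv y := [pick u in U | g u == y].
pose h y := if y \in Z then k y else odflt (k y) (inv y).
have invP y : y \in R -> y \notin Z -> exists2 u, inv y = Some u & u \in U /\ g u = y.
  move=> yR yZ; rewrite /inv; case: pickP => [u /andP[uU /eqP eqg]|none]; first by exists u.
  case/negP: yZ; rewrite inE yR; apply/exists_inP; exists y; last exact: connect0.
  rewrite in_setD yR andbT; apply/imsetP => -[u uU eqy].
  by have := none u; rewrite uU eqy eqxx.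
have hZ y : y \in Z -> h y = k y by rewrite /h => ->.
have hnZ y : y \in R -> y \notin Z -> h y \in U /\ g (h y) = y.
  move=> yR yZ; rewrite /h (negPf yZ).
  by have [u -> ?] := invP y yR yZ.
have ZR y : y \in Z -> y \in R by rewrite inE => /andP[].
have mixed y z : y \in Z -> z \in R -> z \notin Z -> h y <> h z.
  move=> yZ zR zZ; rewrite hZ // => eqh; have [hU ghz] := hnZ z zR zZ.
  by case/negP: zZ; rewrite -ghz -eqh; apply: stepZ; rewrite // eqh.
exists h; split.
- move=> y z yR zR; have [yZ|yZ] := boolP (y \in Z); have [zZ|zZ] := boolP (z \in Z).
  + by rewrite !hZ //; apply: kI.
  + by move/(mixed y z yZ zR zZ).
  + by move/esym/(mixed z y zZ yR yZ).
  + by move=> eqh; have [_ <-] := hnZ y yR yZ; have [_ <-] := hnZ z zR zZ; rewrite eqh.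
- apply/subsetP => u uU; have [guZ|guZ] := boolP (g u \in Z).
    have [y yZ equ] := ZI u uU guZ.
    by apply/imsetP; exists y; rewrite ?hZ ?ZR.
  apply/imsetP; exists (g u); first exact: gR.
  by have [hU ghu] := hnZ _ (gR u uU) guZ; apply: gI.
- move=> y yR; have [yZ|yZ] := boolP (y \in Z); first by left; apply: hZ.
  by right; apply: hnZ.
Qed.

(** * Joining two blocks through a barrier vertex *)

Section Chains.
Variable G : sgraph.
Implicit Types (A B C D E S X : {set G}) (p q : seq G).

Definition link D v w := exists p, [/\ upath (v :: p), last v p = w,
  {subset v :: p <= D}, odd (size (v :: p)) & matchable (D :\: [set z in v :: p])].

Lemma link_sym D v w : link D v w -> link D w v.
Proof.
case=> p [up lp sp op mp].
have eqr : rev (v :: p) = w :: rev (belast v p) by rewrite lastI rev_rcons lp.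
exists (rev (belast v p)); rewrite -eqr; split.
- by rewrite upath_rev.
- by case: (p) lp => [|x q] //= _; rewrite rev_cons last_rcons.
- by move=> z; rewrite mem_rev; apply: sp.
- by rewrite size_rev.
- by move: mp; congr matchable; apply/setP => z; rewrite !in_setD !in_set mem_rev.
Qed.

Lemma fcrit_link D v w : fcrit D -> v \in D -> w \in D -> link D v w.
Proof.
move=> fD vD wD; have [<-|vw] := eqVneq v w.
  exists [::]; split=> //; first by move=> z; rewrite inE => /eqP->.
  by rewrite set1_seq; apply: fD.
have [[m1 pm1] [m2 pm2]] := (fD v vD, fD w wD).
have [p /= [up sp op pp]] := alternating_path vD wD vw pm1 pm2.
exists (rcons (rcons p (m1 w)) w); split=> //.
- by rewrite last_rcons.
- by rewrite /= !size_rcons /= !negbK.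
- by exists m1.
Qed.

(** What a block hit from [a] and [b] has to offer: either entry can be matched outwards with the
    rest of [D] matched inside, or a path passes through both. Contraction preserves this, but not
    factor-criticality. *)
Definition dlink D a b := exists v w,
  [/\ adj a v, adj b w, matchable (D :\ v), matchable (D :\ w) & link D v w].

Lemma dlink_sym D a b : dlink D a b -> dlink D b a.
Proof.
by case=> v [w [av bw mv mw vw]]; exists w, v; split=> //; apply: link_sym.
Qed.

Section Join.
Variables (D E : {set G}) (s : G).
Hypotheses (dDE : [disjoint D & E]) (sD : s \notin D) (sE : s \notin E).

Definition join := s |: (D :|: E).

Lemma join_path p q v w : upath (rcons p v) -> upath (w :: q) ->
  {subset rcons p v <= D} -> {subset w :: q <= E} -> adj v s -> adj s w ->
  matchable (D :\: [set z in rcons p v]) -> matchable (E :\: [set z in w :: q]) ->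
  let r := rcons p v ++ s :: w :: q in
  [/\ upath r, {subset r <= join} & matchable (join :\: [set z in r])].
Proof.
move=> /andP[pp up] /andP[pq uq] sp sq vs sw mp mq r.
have dis z : z \in rcons p v -> z \notin w :: q.
  by move/sp => zD; apply/negP => /sq; rewrite (disjointFr dDE zD).
have sr : {subset r <= join}.
  move=> z; rewrite /r mem_cat in_cons !inE.
  by case/or3P => [/sp->|->|/sq->]; rewrite ?orbT.
split=> //.
- apply/andP; split.
    have := pp; rewrite /r; case: (p) => [_|x p'] /=; first by rewrite vs sw.
    by rewrite cat_path last_rcons /= vs sw => ->.
  rewrite /r cat_uniq up [uniq (s :: _)]cons_uniq uq (contraNN (sq s) sE) !andbT.
  apply/hasPn => z; rewrite in_cons => /predU1P[->|zq].
    exact: contraNN (sp s) sD.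
  by apply: contraL zq => /dis.
- rewrite (_ : _ :\: _ = (D :\: [set z in rcons p v]) :|: (E :\: [set z in w :: q])).
    apply: matchableU mp mq; apply: disjointW dDE; exact: subsetDl.
  apply/setP => z; rewrite /r /join in_setD in_setU1 !in_setU !in_setD !in_set mem_cat in_cons.
  have [->|zs] /= := eqVneq z s; first by rewrite orbT /= (negPf sD) (negPf sE) !andbF.
  have [zD|zD] := boolP (z \in D).
    rewrite (disjointFr dDE zD) /= andbF !orbF andbT.
    have -> : z \in w :: q = false.
      by apply/negP => /sq; rewrite (disjointFr dDE zD).
    by rewrite orbF !andbT.
  rewrite andbF /= (negPf (contraNN (sp z) zD)) /=.
  by case: (z \in E); rewrite ?andbT ?andbF.
Qed.

Lemma join_tiled v w a b : sat D v a -> sat E w b -> adj s v -> adj s w ->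
  8 <= a + b -> tiled join.
Proof.
move=> [p [up sp op lep mp]] [q [uq sq oq leq mq]] sv sw le8.
have eqr : rcons (rev p) v = rev (v :: p) by rewrite rev_cons.
have [||||ur sr mr] := @join_path (rev p) q v w _ uq _ sq _ sw _ mq.
- by rewrite eqr upath_rev.
- by move=> z; rewrite eqr mem_rev; apply: sp.
- by rewrite adj_sym.
- by move: mp; rewrite eqr; congr matchable; apply/setP => z;
    rewrite !in_setD !in_set mem_rev.
apply: (tiled_path ur sr _ _ mr); rewrite eqr size_cat size_rev /=.
  by move: op oq => /=; clear; lia.
by move: lep leq le8 => /=; clear; lia.
Qed.

(** The passage through [D] may be a single vertex; with [s] and order 3 in [E] this still makes 5.
    So a contracted block that is hit once is never weak. *)
Lemma join_sat v w x : link D v w -> adj s w -> adj s x -> sat E x 3 ->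
  sat join v 5.
Proof.
move=> [p [up lp sp op mp]] sw sx [q [uq sq oq leq mq]].
rewrite lastI lp in up sp op mp; rewrite adj_sym in sw.
have [ur sr mr] := join_path up uq sp sq sw sx mp mq.
have eqr : rcons (belast v p) w ++ s :: x :: q = v :: p ++ s :: x :: q.
  by rewrite -lp -lastI.
rewrite eqr in ur sr mr; exists (p ++ s :: x :: q); split=> //.
  by rewrite size_rcons size_belast in op; move: op oq; rewrite /= size_cat /=;
    clear; lia.
by move: leq; rewrite /= size_cat /=; clear; lia.
Qed.

Lemma join_matchable v w : adj s w -> matchable (D :\ v) -> v \in D -> w \in E ->
  matchable (E :\ w) -> matchable (join :\ v).
Proof.
move=> sw mD vD wE mE.
rewrite (_ : _ :\ v = (D :\ v) :|: ([set s; w] :|: (E :\ w))).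
  apply: matchableU mD (matchableU _ (matchable2 sw) mE).
    rewrite disjoints_subset; apply/subsetP => z /setD1P[zv zD].
    rewrite !inE (disjointFr dDE zD) andbF orbF negb_or.
    apply/andP; split; first by apply: contraTneq zD => ->.
    by apply: contraTneq zD => ->; rewrite (disjointFl dDE wE).
  rewrite disjoints_subset subUset !sub1set !in_setC !in_setD1 eqxx /= andbT.
  by rewrite negb_and sE orbT.
have sv : v != s by apply: contraNneq sD => <-.
have ww : v != w by apply: contraTneq wE => <-; rewrite (disjointFr dDE vD).
have vE : v \notin E by rewrite (disjointFr dDE vD).
apply/setP => z; rewrite !inE; have [->|zv] /= := eqVneq z v.
  by rewrite (negPf sv) (negPf ww) (negPf vE).
have [->|zw] := eqVneq z w; first by rewrite wE !orbT.
by case: (z == s); case: (z \in D).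
Qed.

End Join.

Lemma join_sym D E s : join E D s = join D E s.
Proof. by rewrite /join setUC [E :|: D]setUC setUC. Qed.

Lemma link_in D v w : link D v w -> v \in D /\ w \in D.
Proof.
case=> p [_ <- sp _ _]; split; apply: sp; last exact: mem_last.
by rewrite inE eqxx.
Qed.

(** The passages through [D] and [E] are concatenated at [s]. For the matchings, [s] is matched into
    the part that is not entered. *)
Lemma join_dlink D E s a b : [disjoint D & E] -> s \notin D -> s \notin E ->
  dlink D a s -> dlink E s b -> dlink (join D E s) a b.
Proof.
move=> dDE sD sE [v [w [av sw mv mw lvw]]] [x [y [sx bY mx my lxy]]].
have [vD wD] := link_in lvw; have [xE yE] := link_in lxy.
have dED : [disjoint E & D] by rewrite disjoint_sym.
exists v, y; split=> //.
- exact: (join_matchable dDE sD sE sx mv).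
- by rewrite -join_sym; apply: (join_matchable dED sE sD sw my).
have [p [up lp sp op mp]] := lvw; have [q [uq lq sq oq mq]] := lxy.
rewrite lastI lp in up sp op mp; rewrite adj_sym in sw.
have [ur sr mr] := join_path dDE sD sE up uq sp sq sw sx mp mq.
have eqr : rcons (belast v p) w ++ s :: x :: q = v :: p ++ s :: x :: q.
  by rewrite -lp -lastI.
rewrite eqr in ur sr mr; exists (p ++ s :: x :: q); split=> //.
  by rewrite last_cat.
by rewrite size_rcons size_belast in op; move: op oq; rewrite /= size_cat /=;
  clear; lia.
Qed.

End Chains.

(** * Contracting the barrier vertices one by one *)

Section Assembly.
Variable G : sgraph.
Implicit Types (A B C D E S X : {set G}) (P : {set {set G}}) (x y z : G * bool) (blk : G * bool -> {set G})
  (weak : G * bool -> bool).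

Definition spread S (blk : G * bool -> {set G}) :=
  S :|: \bigcup_(y | y.1 \in S) blk y.

Lemma in_spread S blk v : reflect (v \in S \/ exists2 y, y.1 \in S & v \in blk y)
  (v \in spread S blk).
Proof.
rewrite inE; apply: (iffP orP) => -[vS|]; try by left.
  by case/bigcupP => y; right; exists y.
by case=> y yS vy; right; apply/bigcupP; exists y.
Qed.

(* The slots of [s] are [(s, false)] and [(s, true)]; [blk y] is the block attached to
   slot [y]. *)
Record wiring S (blk : G * bool -> {set G}) (weak : G * bool -> bool) : Prop := {
  wiring_out : forall y, y.1 \in S -> [disjoint blk y & S];
  wiring_disj : forall y z, y.1 \in S -> z.1 \in S -> blk y != blk z ->
    [disjoint blk y & blk z];
  wiring_two : forall x y z, x.1 \in S -> y.1 \in S -> z.1 \in S ->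
    uniq [:: x; y; z] -> blk x = blk y -> blk y = blk z -> False;
  wiring_single : forall y, y.1 \in S ->
    (forall z, z.1 \in S -> blk z = blk y -> z = y) ->
    exists2 v, adj y.1 v & sat (blk y) v (if weak y then 3 else 5);
  wiring_double : forall y z, y.1 \in S -> z.1 \in S -> y != z ->
    blk y = blk z -> dlink (blk y) y.1 z.1;
  wiring_strong : forall s, s \in S -> blk (s, false) != blk (s, true) ->
    ~~ (weak (s, false) && weak (s, true)) }.

(* A vertex [s] whose slots hold different blocks [D] and [E] is merged with them into
   the block [M]. *)
Lemma wiring_tiled S blk weak : wiring S blk weak -> tiled (spread S blk).
Proof.
have [n] := ubnP #|S|; elim: n S blk weak => // n IHn S blk weak leSn W.
have [H1 H2 H3 H4 H5 H6] := W.
have [->|[s sS]] := set_0Vmem S.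
  rewrite (_ : spread _ _ = set0); first exact: Tiled0.
  by apply/setP => v; rewrite in_set0; apply/negbTE/negP => /in_spread[|[y]]; rewrite inE.
pose S' := S :\ s; pose y0 := (s, false); pose y1 := (s, true).
have S'S t : t \in S' -> t \in S by rewrite inE => /andP[].
have S's y : y.1 \in S' -> y != y0 /\ y != y1.
  by rewrite in_setD1 => /andP[ys _]; split; apply: contraNneq ys => ->.
have leS'n : #|S'| < n by rewrite (cardsD1 s) sS in leSn.
have splitS y : y.1 \in S -> [\/ y.1 \in S', y = y0 | y = y1].
  case: y => t b /= tS; have [->|ts] := eqVneq t s.
    by case: b; [apply: Or33|apply: Or32].
  by apply: Or31; rewrite in_setD1 ts.
have y01 : y0 != y1 by rewrite xpair_eqE andbF.
set D := blk y0; set E := blk y1.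
have sD : s \notin D by rewrite (disjointFl (H1 y0 sS) sS).
have sE : s \notin E by rewrite (disjointFl (H1 y1 sS) sS).
(* If [s] has both slots in one block, no other slot holds it by [wiring_two], and [s |: D] splits
   off as a matched set. *)
have [eqDE|neDE] := eqVneq D E.
  have offD y : y.1 \in S' -> blk y != D.
    move=> yS'; have [ne0 ne1] := S's y yS'; apply/eqP => eqy.
    apply: (H3 y y0 y1) => //; first exact: S'S.
    by rewrite /= !inE negb_or ne0 ne1 y01.
  have [v [w [sv _ mv _ lvw]]] : dlink D s s := H5 y0 y1 sS sS y01 eqDE.
  have [vD _] := link_in lvw.
  have tD : tiled (s |: D).
    rewrite -(setD1K vD) setUA; apply: tiled_U (tiled2 sv) (matchable_tiled mv).
    rewrite disjoints_subset subUset !sub1set !in_setC !in_setD1 eqxx andbT /=.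
    by rewrite negb_and sD orbT.
  have -> : spread S blk = (s |: D) :|: spread S' blk.
    apply/setP => x; apply/in_spread/setUP => [[xS|[y yS xy]]|[/setU1P[->|xD]|]].
    - have [->|xs] := eqVneq x s; first by left; rewrite setU11.
      by right; apply/in_spread; left; rewrite in_setD1 xs.
    - have [yS'|eqy|eqy] := splitS y yS.
      + by right; apply/in_spread; right; exists y.
      + by left; rewrite in_setU1 -/D /D -eqy xy orbT.
      + by left; rewrite in_setU1 eqDE /E -eqy xy orbT.
    - by left.
    - by right; exists y0.
    - by case/in_spread => [/S'S|[y /S'S ? ?]]; [left|right; exists y].
  apply: tiled_U => //.
    rewrite disjoints_subset; apply/subsetP => x xsD; rewrite in_setC.
    apply/in_spread => -[xS'|[y yS' xy]].
      case/setU1P: xsD => [eqx|xD]; first by rewrite eqx !inE eqxx in xS'.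
      by have := disjointFr (H1 y0 sS) xD; rewrite S'S.
    case/setU1P: xsD => [eqx|xD].
      by have := disjointFr (H1 y (S'S _ yS')) xy; rewrite eqx sS.
    by have := disjointFr (H2 y y0 (S'S _ yS') sS (offD y yS')) xy; rewrite xD.
  apply: (IHn S' blk weak leS'n); split.
  - move=> y /S'S/H1; rewrite !disjoints_subset => /subset_trans; apply.
    by rewrite setCS subsetDl.
  - by move=> y z /S'S yS /S'S zS; apply: H2.
  - by move=> x y z /S'S xS /S'S yS /S'S zS; apply: H3.
  - move=> y yS' single; apply: H4; first exact: S'S.
    move=> z zS eqz; have [zS'|eqz0|eqz1] := splitS z zS; first exact: single.
      by case/eqP: (offD y yS'); rewrite -eqz eqz0.
    by case/eqP: (offD y yS'); rewrite -eqz eqz1 eqDE.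
  - by move=> y z /S'S yS /S'S zS; apply: H5.
  - by move=> t /S'S tS; apply: H6.
have dDE : [disjoint D & E] by apply: H2.
have dED : [disjoint E & D] by rewrite disjoint_sym.
pose hit y := (blk y == D) || (blk y == E).
pose M := join D E s.
have eqM : M = join E D s by rewrite -join_sym.
pose blk' y := if hit y then M else blk y.
pose weak' y := ~~ hit y && weak y.
have sM : s \in M by rewrite !inE eqxx.
have hitM y : hit y -> blk' y = M by rewrite /blk' => ->.
have nhit y : ~~ hit y -> blk' y = blk y by rewrite /blk' => /negPf->.
have nhit_disj y : y.1 \in S -> ~~ hit y -> [disjoint blk y & M].
  move=> yS; rewrite negb_or => /andP[nD nE]; rewrite disjoint_sym disjoints_subset.
  rewrite !subUset sub1set in_setC (disjointFl (H1 y yS) sS) /=.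
  by rewrite -!disjoints_subset ![[disjoint _ & blk y]]disjoint_sym !H2.
have hit_eq y z : y.1 \in S -> z.1 \in S -> blk' y = blk' z -> hit y = hit z.
  move=> yS zS; have [hy|hy] := boolP (hit y); have [hz|hz] := boolP (hit z) => //.
    rewrite (hitM y hy) (nhit z hz) => eqz; have := disjointFl (H1 z zS) sS.
    by rewrite -eqz sM.
  rewrite (hitM z hz) (nhit y hy) => eqz; have := disjointFl (H1 y yS) sS.
  by rewrite eqz sM.
have twoD y z : y.1 \in S' -> z.1 \in S' -> y != z -> blk y = D -> blk z <> D.
  move=> yS' zS' yz yD zD; have [[ny _] [nz _]] := (S's y yS', S's z zS').
  apply: (H3 y z y0 (S'S _ yS') (S'S _ zS') sS); rewrite ?yD ?zD //.
  by rewrite /= !inE negb_or yz ny nz.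
have twoE y z : y.1 \in S' -> z.1 \in S' -> y != z -> blk y = E -> blk z <> E.
  move=> yS' zS' yz yD zD; have [[_ ny] [_ nz]] := (S's y yS', S's z zS').
  apply: (H3 y z y1 (S'S _ yS') (S'S _ zS') sS); rewrite ?yD ?zD //.
  by rewrite /= !inE negb_or yz ny nz.
have linkD y : y.1 \in S' -> blk y = D -> dlink D y.1 s.
  move=> yS' yD; have [ny _] := S's y yS'; rewrite -yD.
  by apply: (H5 y y0) => //; apply: S'S.
have linkE y : y.1 \in S' -> blk y = E -> dlink E y.1 s.
  move=> yS' yE; have [_ ny] := S's y yS'; rewrite -yE.
  by apply: (H5 y y1) => //; apply: S'S.
have W' : wiring S' blk' weak'.
  split.
  - move=> y yS'; have yS := S'S _ yS'; have [hy|hy] := boolP (hit y).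
      rewrite hitM // disjoints_subset !subUset sub1set in_setC !inE eqxx /=.
      have sub : ~: S \subset ~: S' by rewrite setCS subsetDl.
      by rewrite !(subset_trans _ sub) // -disjoints_subset; apply: H1.
    rewrite nhit //; have := H1 y yS; rewrite !disjoints_subset => /subset_trans; apply.
    by rewrite setCS subsetDl.
  - move=> y z yS' zS'; have [yS zS] := (S'S _ yS', S'S _ zS').
    have [hy|hy] := boolP (hit y); have [hz|hz] := boolP (hit z).
    + by rewrite (hitM y hy) (hitM z hz) eqxx.
    + by rewrite (hitM y hy) (nhit z hz) disjoint_sym nhit_disj.
    + by rewrite (nhit y hy) (hitM z hz) nhit_disj.
    + by rewrite (nhit y hy) (nhit z hz); apply: H2.
  - move=> x y z xS' yS' zS' u3 eqxy eqyz.
    have [[xS yS] zS] := (S'S _ xS', S'S _ yS', S'S _ zS').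
    have hxy := hit_eq x y xS yS eqxy; have hyz := hit_eq y z yS zS eqyz.
    have [hx|hx] := boolP (hit x); last first.
      have hy : ~~ hit y by rewrite -hxy.
      have hz : ~~ hit z by rewrite -hyz.
      rewrite (nhit x hx) (nhit y hy) in eqxy; rewrite (nhit y hy) (nhit z hz) in eqyz.
      exact: (H3 x y z).
    have hy : hit y by rewrite -hxy.
    have hz : hit z by rewrite -hyz.
    move: u3; rewrite /= !inE negb_or andbT => /andP[/andP[nxy nxz] nyz].
    case/orP: hx => /eqP hx; case/orP: hy => /eqP hy; case/orP: hz => /eqP hz.
    + exact: (twoD x y xS' yS').
    + exact: (twoD x y xS' yS').
    + exact: (twoD x z xS' zS').
    + exact: (twoE y z yS' zS').
    + exact: (twoD y z yS' zS').
    + exact: (twoE x z xS' zS').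
    + exact: (twoE x y xS' yS').
    + exact: (twoE x y xS' yS').
  - move=> y yS' single; have yS := S'S _ yS'.
    have [hy|hy] := boolP (hit y); last first.
      rewrite /weak' hy nhit //; apply: H4 => // z zS eqz.
      have hz : ~~ hit z by rewrite /hit eqz.
      have [zS'|eqz0|eqz1] := splitS z zS.
      + by apply: single; rewrite // (nhit z hz) (nhit y hy).
      + by case/negP: hz; rewrite eqz0 /hit eqxx.
      + by case/negP: hz; rewrite eqz1 /hit eqxx orbT.
    (* [M] is held by [y] alone, through [D] or through [E]. The other of the two is held only by a
       slot of [s], and even a weak slot gives the order 3 that [join_sat] asks for. *)
    rewrite /weak' hy hitM //=.
    have only z : z.1 \in S' -> hit z -> z = y.
      by move=> zS' hz; apply: single; rewrite // (hitM z hz) (hitM y hy).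
    have get3 z b : sat (blk z) b (if weak z then 3 else 5) -> sat (blk z) b 3.
      by apply: sat_leq; case: (weak z).
    case/orP: (hy) => /eqP yD.
      have [v [w [yv sw _ _ lvw]]] := linkD y yS' yD.
      have [|x sx satx] := H4 y1 sS.
        move=> z zS eqz; have [zS'|eqz0|//] := splitS z zS.
          have eqzy : z = y by apply: only; rewrite // /hit eqz eqxx orbT.
          by case/eqP: neDE; rewrite -yD -eqzy eqz.
        by case/eqP: neDE; rewrite /D -eqz0 eqz.
      by exists v => //; apply: (join_sat dDE sD sE lvw sw sx (get3 y1 x satx)).
    have [v [w [yv sw _ _ lvw]]] := linkE y yS' yD.
    have [|x sx satx] := H4 y0 sS.
      move=> z zS eqz; have [zS'|//|eqz1] := splitS z zS.
        have eqzy : z = y by apply: only; rewrite // /hit eqz eqxx.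
        by case/eqP: neDE; rewrite -yD -eqzy eqz.
      by case/eqP: neDE; rewrite /E -eqz1 eqz.
    by exists v => //; rewrite eqM; apply: (join_sat dED sE sD lvw sw sx (get3 y0 x satx)).
  - move=> y z yS' zS' yz eqyz; have [yS zS] := (S'S _ yS', S'S _ zS').
    have hyz := hit_eq y z yS zS eqyz.
    have [hy|hy] := boolP (hit y); last first.
      have hz : ~~ hit z by rewrite -hyz.
      by rewrite (nhit y hy) (nhit z hz) in eqyz *; apply: H5.
    have hz : hit z by rewrite -hyz.
    rewrite hitM //; case/orP: hy => /eqP hy; case/orP: hz => /eqP hz.
    + by case: (twoD y z yS' zS' yz hy hz).
    + apply: join_dlink => //; [exact: linkD|apply: dlink_sym; exact: linkE].
    + rewrite eqM; apply: join_dlink => //; [exact: linkE|apply: dlink_sym; exact: linkD].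
    + by case: (twoE y z yS' zS' yz hy hz).
  - move=> t tS' ne; have tS := S'S _ tS'.
    apply/negP => /andP[/andP[h0 w0] /andP[h1 w1]].
    by rewrite (nhit _ h0) (nhit _ h1) in ne; have := H6 t tS ne; rewrite w0 w1.
have tW' := IHn S' blk' weak' leS'n W'.
have inM (x : G) : x \in M -> [\/ x = s, x \in D | x \in E].
  by rewrite !inE => /or3P[/eqP->|?|?]; [apply: Or31|apply: Or32|apply: Or33].
have DM (x : G) : x \in D -> x \in M by move=> xD; rewrite !inE xD orbT.
have EM (x : G) : x \in E -> x \in M by move=> xE; rewrite !inE xE !orbT.
have back (x : G) : x \in M :|: spread S' blk' -> x \in spread S blk.
  move=> xM; have {xM} : x \in M \/ x \in spread S' blk' by apply/setUP.
  have M_in : x \in M -> x \in spread S blk.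
    move=> /inM[->|xD|xE]; apply/in_spread; [by left|right; by exists y0|right; by exists y1].
  case=> [/M_in//|/in_spread[/S'S xS|[y yS']]]; first by apply/in_spread; left.
  rewrite /blk'; case: ifP => _ xy; first exact: M_in.
  by apply/in_spread; right; exists y => //; apply: S'S.
have forth (x : G) : x \in spread S blk -> x \in M :|: spread S' blk'.
  case/in_spread => [xS|[y yS xy]]; apply/setUP.
    have [->|xs] := eqVneq x s; first by left.
    by right; apply/in_spread; left; rewrite in_setD1 xs.
  have [hy|hy] := boolP (hit y).
    by left; case/orP: hy => /eqP hy; rewrite hy in xy; [apply: DM|apply: EM].
  have [yS'|eqy|eqy] := splitS y yS.
  - by right; apply/in_spread; right; exists y; rewrite ?nhit.
  - by case/negP: hy; rewrite eqy /hit eqxx.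
  - by case/negP: hy; rewrite eqy /hit eqxx orbT.
have eqS : spread S blk = M :|: spread S' blk'.
  by apply/setP => x; apply/idP/idP; [apply: forth|apply: back].
(* If another slot holds [M], the tiling from the induction covers it already. Otherwise [D] and [E]
   are held by [s] alone, not both weakly, and a path of order at least 3 + 1 + 5 finishes [M]. *)
have [[z zS' hz]|nohit] := classic (exists2 z, z.1 \in S' & hit z).
  rewrite eqS (setUidPr _) //; apply/subsetP => x xM; apply/in_spread; right.
  by exists z; rewrite ?hitM.
have nhS' y : y.1 \in S' -> ~~ hit y.
  by move=> yS'; apply/negP => hy; apply: nohit; exists y.
have [|v sv satv] := H4 y0 sS.
  move=> z zS eqz; have [zS'|//|eqz1] := splitS z zS.
    by case/negP: (nhS' z zS'); rewrite /hit eqz eqxx.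
  by case/eqP: neDE; rewrite /E -eqz1 eqz.
have [|w sw satw] := H4 y1 sS.
  move=> z zS eqz; have [zS'|eqz0|//] := splitS z zS.
    by case/negP: (nhS' z zS'); rewrite /hit eqz eqxx orbT.
  by case/eqP: neDE; rewrite /D -eqz0 eqz.
rewrite eqS; apply: tiled_U => //.
  rewrite disjoint_sym disjoints_subset; apply/subsetP => x; rewrite in_setC.
  case/in_spread => [xS'|[y yS']].
    apply/negP => /inM[eqx|xD|xE].
    - by rewrite eqx !inE eqxx in xS'.
    - by have := disjointFr (H1 y0 sS) xD; rewrite S'S.
    - by have := disjointFr (H1 y1 sS) xE; rewrite S'S.
  rewrite nhit ?nhS' // => xy.
  by rewrite (disjointFr (nhit_disj y (S'S _ yS') (nhS' y yS')) xy).
apply: (join_tiled dDE sD sE satv satw sv sw).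
by have := H6 s sS neDE; case: (weak _); case: (weak _).
Qed.

End Assembly.

(** * From the weight condition to a tiling *)

Section Main.
Variable G : sgraph.
Implicit Types (A B C D E S X : {set G}) (P Q : {set {set G}}).

Lemma weight_family A Q (F : {set G} -> {set G}) :
  (forall D, D \in Q -> F D \subset A) ->
  (forall D E, D \in Q -> E \in Q -> D != E -> [disjoint F D & F E]) ->
  (forall D x y, D \in Q -> x \in F D -> y \in A -> adj x y -> y \in F D) ->
  \sum_(D in Q) weight (F D) <= weight A.
Proof.
have [n] := ubnP #|Q|; elim: n Q A => // n IHn Q A leQn sF dF cF.
have [->|[D DQ]] := set_0Vmem Q; first by rewrite big_set0.
have QD E : E \in Q :\ D -> E \in Q /\ E != D by case/setD1P.
rewrite (big_setD1 D) //= -(setID A (F D)) (setIidPr (sF D DQ)).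
apply: leq_trans (weightU _ _).
- rewrite leq_add2l; apply: IHn.
  + by rewrite (cardsD1 D) DQ in leQn.
  + by move=> E /QD[EQ neED]; rewrite subsetD sF //=; apply: dF.
  + by move=> E E' /QD[EQ _] /QD[EQ' _]; apply: dF.
  + by move=> E x y /QD[EQ _] xE /setDP[yA _]; apply: cF.
- by rewrite disjoints_subset setCD subsetUr.
- by move=> x y xD /setDP[yA yD]; apply: contra yD => xy; apply: cF xD yA xy.
Qed.

Lemma tiled_family A Q : tiled A -> (forall D, D \in Q -> tiled D) ->
  (forall D, D \in Q -> [disjoint A & D]) ->
  (forall D E, D \in Q -> E \in Q -> D != E -> [disjoint D & E]) ->
  tiled (A :|: cover Q).
Proof.
have [n] := ubnP #|Q|; elim: n Q A => // n IHn Q A leQn tA tQ dA dQ.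
have [->|[D DQ]] := set_0Vmem Q; first by rewrite /cover big_set0 setU0.
have QD E : E \in Q :\ D -> E \in Q /\ E != D by case/setD1P.
rewrite /cover (big_setD1 D) //= setUA; apply: IHn.
- by rewrite (cardsD1 D) DQ in leQn.
- by apply: tiled_U => //; [apply: dA|apply: tQ].
- by move=> E /QD[EQ _]; apply: tQ.
- move=> E /QD[EQ nED]; rewrite disjoints_subset subUset -!disjoints_subset.
  by rewrite dA //= dQ // eq_sym.
- by move=> E E' /QD[EQ _] /QD[EQ' _]; apply: dQ.
Qed.

Lemma tiled_of_weight : (forall X, weight (~: X) <= 2 * #|X|) -> tiled [set: G].
Proof.
move=> wG; have [eqT|[v0 _]] := set_0Vmem [set: G]; first by rewrite eqT; apply: Tiled0.
have [S [P [f [[_ sP injP clP] covP critP fI fP]]]] := barrier [set: G].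
have [c cP] : exists c : {set G} -> {set G} * nat, forall D, D \in P ->
    [/\ (c D).2 <= 2, (c D).1 \subset D,
        2 * #|(c D).1| + (c D).2 <= weight (D :\: (c D).1),
        (c D).2 = 0 -> tiled D
      & (c D).2 < 2 -> (forall v, v \in D -> sat D v 3) /\
               (forall v, v \in D :\: (c D).1 -> sat D v 5)].
  apply: (fin_all_exists (P := fun D (u : {set G} * nat) => D \in P ->
    [/\ u.2 <= 2, u.1 \subset D, 2 * #|u.1| + u.2 <= weight (D :\: u.1),
        u.2 = 0 -> tiled D
      & u.2 < 2 -> (forall v, v \in D -> sat D v 3) /\
               (forall v, v \in D :\: u.1 -> sat D v 5)])) => D.
  have [DP|nDP] := boolP (D \in P); last by exists (set0, 0).
  have [fD D0] := critP D DP; have [X [t Xt]] := fcrit_classify fD D0.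
  by exists (X, t).
pose K D := (c D).1; pose t D := (c D).2.
have dP D E : D \in P -> E \in P -> D != E -> [disjoint D & E].
  move=> DP EP; apply: contraNT; rewrite -setI_eq0 => /set0Pn[x].
  by rewrite inE => /andP[xD xE]; apply/eqP; apply: injP xD xE.
have PS D x : D \in P -> x \in D -> x \notin S.
  by move=> DP /(subsetP (sP D DP)); rewrite inE => /andP[].
(* The block [D] requires the units [(D, b)] with [b < t D]; a unit is to be mapped to a
   slot. *)
pose U := [set u : {set G} * bool | (u.1 \in P) && (u.2 < t u.1)].
pose R := [set y : G * bool | y.1 \in S].
pose r (u : {set G} * bool) (y : G * bool) :=
  (y.1 \in S) && [exists v in u.1 :\: K u.1, adj y.1 v].
have hallU (Y : {set {set G} * bool}) : Y \subset U -> #|Y| <= #|image_rel r Y|.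
  move=> sY; pose Q := [set u.1 | u in Y].
  have QP D : D \in Q -> D \in P.
    by case/imsetP => u /(subsetP sY); rewrite inE => /andP[uP _] ->.
  pose N := [set s in S | [exists D in Q, [exists v in D :\: K D, adj s v]]].
  have cN : 2 * #|N| <= #|image_rel r Y|.
    rewrite mulnC -card_bool -cardsT -cardsX; apply: subset_leq_card.
    apply/subsetP => -[s b]; rewrite !inE /= andbT => /andP[sS /exists_inP[D]].
    case/imsetP => u uY -> exv; apply/exists_inP; exists u; rewrite // /r /=.
    by rewrite sS.
  have cY : #|Y| <= \sum_(D in Q) t D.
    rewrite -sum1_card (partition_big fst (mem Q)) /=; last first.
      by move=> u uY; apply: imset_f.
    apply: leq_sum => D DQ; rewrite sum1dep_card.
    have [t2 _ _ _ _] := cP D (QP D DQ).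
    apply: (@leq_trans #|[set b : bool | b < t D]|).
      rewrite -(card_imset (mem [set b : bool | b < t D]) (f := fun b => (D, b))).
        apply: subset_leq_card; apply/subsetP => -[D' b]; rewrite inE /=.
        case/andP => uY /eqP eqD; apply/imsetP; exists b; last by rewrite -eqD.
        by have := subsetP sY _ uY; rewrite !inE /= eqD => /andP[].
      by move=> b b' [].
    rewrite -sum1dep_card big_mkcond /=.
    rewrite (_ : \sum_(b : bool) _ = (1 < t D) + (0 < t D)); last first.
      by rewrite big_bool /=; case: (1 < _); case: (0 < _).
    by move: t2; rewrite -/(t D); case: (t D) => [|[|[|]]].
  apply: leq_trans cY (leq_trans _ cN).
  (* Deleting [X] separates the sets [D :\: K D], of weight at least 2|[K D]| + [t D] each. The
     hypothesis bounds their sum by 2|[X]|; cancelling the sizes of the sets [K D] leaves the sum of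
     [t D] at most 2|[N]|. *)
  pose X := N :|: \bigcup_(D in Q) K D.
  have cX : #|X| <= #|N| + \sum_(D in Q) #|K D|.
    apply: leq_trans (leq_card_setU _ _) _; rewrite leq_add2l.
    elim/big_rec2: _ => [|D a B _ leB]; first by rewrite cards0.
    by apply: leq_trans (leq_card_setU _ _) _; rewrite leq_add2l.
  have : \sum_(D in Q) weight (D :\: K D) <= weight (~: X).
    apply: (weight_family (F := fun D => D :\: K D)).
    - move=> D DQ; apply/subsetP => x /setDP[xD xK]; rewrite in_setC in_setU negb_or.
      rewrite inE (negPf (PS D x (QP D DQ) xD)) /=; apply/bigcupP => -[E EQ xE].
      have [_ sE _ _ _] := cP E (QP E EQ).
      have eqDE := injP D E x (QP D DQ) (QP E EQ) xD (subsetP sE x xE).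
      by rewrite eqDE xE in xK.
    - move=> D E DQ EQ neDE; apply: disjointW (dP D E (QP D DQ) (QP E EQ) neDE).
        exact: subsetDl.
      exact: subsetDl.
    - move=> D x y DQ /[dup] xDK /setDP[xD xK]; rewrite in_setC in_setU negb_or.
      case/andP => yN yK xy; have DP := QP D DQ.
      have yS : y \notin S.
        apply: contra yN => yS; rewrite inE yS; apply/exists_inP; exists D => //.
        by apply/exists_inP; exists x; rewrite // adj_sym.
      rewrite in_setD; apply/andP; split; last first.
        by apply: clP xD _ xy; rewrite // in_setD yS inE.
      by apply: contra yK => yK; apply/bigcupP; exists D.
  move/leq_trans/(_ (wG X)) => le1.
  have le2 : \sum_(D in Q) (2 * #|K D| + t D) <= \sum_(D in Q) weight (D :\: K D).
    by apply: leq_sum => D /QP/cP[].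
  move: (leq_trans le2 le1) cX; rewrite big_split -big_distrr /=.
  move: (\sum_(D in Q) #|K D|) (\sum_(D in Q) t D) #|X| #|N|; clear => a b x y.
  by lia.
have [g gI gr] := hall (v0, true) hallU.
have gR u : u \in U -> g u \in R by move=> /gr/andP[]; rewrite inE.
(* The matching of the barrier offers both slots of [s] to the block [f s]. The Boolean keeps [k]
   injective; its value need not be a required unit. *)
pose k (y : G * bool) := (f y.1, y.2).
have kI : {in R &, injective k}.
  by move=> [s b] [s' b']; rewrite !inE /= => sS sS' [/fI-> // ->].
have [h [hI sUh hk]] := injection_merge gI kI gR.
(* The edge from [s] to [f s] may end in [K (f s)], so that a slot filled by [k] is weak;
   but if both slots of [s] are, they hold the same block. *)
pose blk y := (h y).1; pose weak y := h y == k y.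
have inR y : (y \in R) = (y.1 \in S) by rewrite inE.
have blkP y : y.1 \in S -> blk y \in P.
  rewrite -inR => yR; have [eqh|[hU _]] := hk y yR.
    by rewrite /blk eqh /=; have [] := fP y.1 _; rewrite -?inR.
  by move: hU; rewrite inE => /andP[].
have adjb y : y.1 \in S -> exists2 v, v \in blk y & adj y.1 v.
  move=> yS; have [eqh|[hU ghy]] := hk y (etrans (inR y) yS).
    by rewrite /blk eqh /=; have [] := fP y.1 yS.
  have /andP[_ /exists_inP[v]] := gr _ hU; rewrite ghy => /setDP[vD _] yv.
  by exists v.
have W : wiring S blk weak.
  split.
  - move=> y yS; rewrite disjoints_subset; apply/subsetP => x xb.
    by rewrite in_setC; apply: PS xb; apply: blkP.
  - by move=> y z yS zS; apply: dP; apply: blkP.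
  - move=> x y z xS yS zS u3 eqxy eqyz.
    (* By injectivity of [h], slots holding the same block differ in a Boolean, so there are at most
       two of them. *)
    have ne a b : a.1 \in S -> b.1 \in S -> a != b -> blk a = blk b -> (h a).2 != (h b).2.
      move=> aS bS ab eqb; apply: contra ab => /eqP eq2; apply/eqP; apply: hI.
      - by rewrite inR.
      - by rewrite inR.
      - by rewrite [LHS]surjective_pairing [RHS]surjective_pairing eq2 -/(blk a) eqb.
    move: u3; rewrite /= !inE negb_or andbT => /andP[/andP[nxy nxz] nyz].
    have := ne x y xS yS nxy eqxy; have := ne y z yS zS nyz eqyz.
    have := ne x z xS zS nxz (etrans eqxy eqyz).
    by case: (h x).2; case: (h y).2; case: (h z).2.
  - move=> y yS single; have bP := blkP y yS.
    have [t2 _ _ _ satD] := cP _ bP.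
    (* If [t] were 2, both units of the block would be values of [h], at two different slots. *)
    have lt2 : t (blk y) < 2.
      rewrite ltnNge; apply/negP => ge2.
      have inU b : (blk y, b) \in U.
        by rewrite inE /= bP; apply: leq_ltn_trans ge2; case: b.
      have get b : exists2 z, z.1 \in S & h z = (blk y, b).
        have /imsetP[z zR eqz] := subsetP sUh _ (inU b); exists z => //.
        by rewrite -inR.
      have [z1 z1S e1] := get true; have [z2 z2S e2] := get false.
      have eq1 : z1 = y by apply: single; rewrite // /blk e1.
      have eq2 : z2 = y by apply: single; rewrite // /blk e2.
      by move: e1; rewrite eq1 -eq2 e2.
    have [sat3 sat5] := satD lt2; rewrite /weak.
    case: ifPn => [_|nk].
      by have [v vb yv] := adjb y yS; exists v => //; apply: sat3.
    have [eqh|[hU ghy]] := hk y (etrans (inR y) yS); first by rewrite eqh eqxx in nk.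
    have /andP[_ /exists_inP[v vK yv]] := gr _ hU; rewrite ghy in yv.
    by exists v => //; apply: sat5.
  - move=> y z yS zS yz eqyz; have [fb _] := critP _ (blkP y yS).
    have [v vb yv] := adjb y yS; have [w wb zw] := adjb z zS; rewrite -eqyz in wb.
    by exists v, w; split=> //; [apply: fb|apply: fb|apply: fcrit_link].
  - move=> s sS; apply: contra => /andP[/eqP k0 /eqP k1].
    by rewrite /blk k0 k1.
(* Every required unit is a value of [h], so a block held by no slot has [t D = 0] and is tiled by
   itself. *)
pose Q := [set D in P | [forall y in R, blk y != D]].
have -> : [set: G] = spread S blk :|: cover Q.
  apply/esym/setP => x; rewrite in_setT; apply/setUP.
  have [xS|xS] := boolP (x \in S); first by left; apply/in_spread; left.
  have /bigcupP[D DP xD] : x \in cover P by apply: (subsetP covP); rewrite !inE xS.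
  have [/forall_inP hit|] := boolP [forall y in R, blk y != D].
    by right; apply/bigcupP; exists D => //; rewrite inE DP; apply/forall_inP.
  rewrite negb_forall => /existsP[y]; rewrite negb_imply negbK inR => /andP[yS /eqP eqD].
  by left; apply/in_spread; right; exists y; rewrite ?eqD.
apply: tiled_family (wiring_tiled W) _ _ _.
- move=> D; rewrite inE => /andP[DP /forall_inP nhit]; have [_ _ _ t0 _] := cP D DP.
  apply: t0; apply/eqP; rewrite -leqn0 leqNgt; apply/negP => t_gt0.
  have /imsetP[y yR eqy] : (D, false) \in h @: R.
    by apply: (subsetP sUh); rewrite inE /= DP.
  by have := nhit y yR; rewrite /blk -eqy eqxx.
- move=> D; rewrite inE => /andP[DP /forall_inP nhit].
  rewrite disjoint_sym disjoints_subset; apply/subsetP => x xD; rewrite in_setC.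
  apply/in_spread => -[xS|[y yS xy]]; first by have := PS D x DP xD; rewrite xS.
  have := nhit y; rewrite inR => /(_ yS) neD.
  by have := disjointFr (dP _ _ (blkP y yS) DP neD) xy; rewrite xD.
- by move=> D E; rewrite !inE => /andP[DP _] /andP[EP _]; apply: dP.
Qed.

End Main.

(** * The factor *)

Section Factor.
Variable G : sgraph.
Implicit Types (A : {set G}) (p : seq G).

Definition consecutive p (a b : G) :=
  ((index a p).+1 == index b p) || ((index b p).+1 == index a p).

Lemma consecutive_adj p a b : sorted (@adj G) p -> a \in p -> b \in p ->
  consecutive p a b -> adj a b.
Proof.
have next c d : sorted (@adj G) p -> c \in p -> d \in p ->
    (index c p).+1 == index d p -> adj c d.
  move=> /(sortedP c) sp cp dp /eqP eqi.
  have := sp (index c p); rewrite eqi index_mem dp !nth_index //; exact.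
move=> sp ap bp /orP[]; first exact: next.
by rewrite adj_sym; apply: next.
Qed.

(** [F] keeps only the edges between consecutive vertices of a tile. With chords and edges between
    tiles dropped, its components on [A] are exactly the tiles. *)
Lemma tiled_relation A : tiled A -> exists F : rel G,
  [/\ symmetric F, subrel F (@adj G), forall a b, F a b -> a \in A
    & forall x, x \in A -> exists p,
      [/\ x \in p, uniq p, (size p == 2) || (size p == 9), {subset p <= A}
        & forall a b, a \in p -> F a b = (b \in p) && consecutive p a b]].
Proof.
elim=> [|p B /andP[sp up] szp dpB _ [F [Fsym FG FB FP]]].
  by exists (fun _ _ => false); split=> // x; rewrite inE.
have nB a : a \in p -> a \notin B.
  by move=> ap; have := disjointFr dpB (x := a); rewrite inE => -> //.
exists (fun a b => if a \in p then (b \in p) && consecutive p a b else F a b).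
split.
- move=> a b; case: ifPn => ap; case: ifPn => bp //=.
  + by rewrite /consecutive orbC.
  + by apply/esym/negbTE; rewrite Fsym; apply: contra (nB a ap) => /FB.
  + by apply/negbTE; rewrite Fsym; apply: contra (nB b bp) => /FB.
- move=> a b; case: ifPn => [ap /andP[bp]|_]; last exact: FG.
  exact: consecutive_adj.
- by move=> a b; case: ifPn => [ap _|_ /FB aB]; rewrite !inE ?ap ?aB ?orbT.
move=> x /setUP[|xB].
  rewrite inE => xp; exists p; split=> // [a ap|a b ->//].
  by rewrite !inE ap.
have [q [xq uq szq sq Fq]] := FP x xB; exists q; split=> // [a aq|a b aq].
  by rewrite inE sq ?orbT.
by rewrite ifN ?Fq //; apply: contraTN (sq a aq) => /nB.
Qed.

Lemma tiled_has_factor : tiled [set: G] ->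
  has_factor (fun H => H = path_graph 2 \/ H = path_graph 9) G.
Proof.
move=> /tiled_relation[F [Fsym FG _ FP]].
have Firr : irreflexive F by move=> x; apply/negP => /FG; rewrite adj_irrefl.
exists F, Fsym, Firr; split=> // C /imsetP[x _ eqC].
have [p [xp up szp _ Fp]] := FP x (in_setT x).
have step a b : a \in p -> connect F a b -> b \in p.
  move=> + /connectP[q]; elim: q a => [|c q IHq] a ap /=; first by move=> _ ->.
  by rewrite Fp // => /andP[/andP[cp _] /(IHq c cp)].
have reach i : i < size p -> connect F (nth x p 0) (nth x p i).
  elim: i => [|i IHi] lti; first exact: connect0.
  apply: connect_trans (IHi (ltnW lti)) (connect1 _).
  by rewrite Fp ?mem_nth ?(ltnW lti) // /consecutive !index_uniq ?eqxx ?(ltnW lti).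
have memC b : (b \in C) = (b \in p).
  rewrite eqC inE; apply/idP/idP; first exact: step.
  move=> bp; apply: (@connect_trans _ _ (nth x p 0)).
    rewrite sym_connect_sym // -{2}(nth_index x xp).
    by apply: reach; rewrite index_mem.
  by rewrite -(nth_index x bp); apply: reach; rewrite index_mem.
have iso n : size p = n ->
    isomorphic (@induced (SGraph Fsym Firr) C) (path_graph n).
  move=> szn; have lt (u : @induced (SGraph Fsym Firr) C) : index (val u) p < n.
    by rewrite -szn index_mem -memC; case: u.
  exists (fun u => Ordinal (lt u) : path_graph n).
    apply: inj_card_bij.
      move=> u v /(congr1 val) /= eqi; apply: val_inj.
      have up' : val u \in p by rewrite -memC; case: u {eqi}.
      have vp' : val v \in p by rewrite -memC; case: v {eqi}.
      by rewrite -(nth_index x up') eqi nth_index.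
    rewrite card_ord card_sig -szn -(card_uniqP up); apply: subset_leq_card.
    by apply/subsetP => b; rewrite -memC.
  move=> u v; have up' : val u \in p by rewrite -memC; case: u.
  have vp' : val v \in p by rewrite -memC; case: v.
  by rewrite [RHS]Fp // vp'.
case/orP: szp => /eqP szp.
  by exists (path_graph 2); [left|apply: iso].
by exists (path_graph 9); [right|apply: iso].
Qed.

End Factor.

Local Open Scope ring_scope.

Theorem theorem1p2 (G : sgraph) :
  (forall X : {set G},
     (ncomp 1 (delete X))%:R + (ncomp 3 (delete X))%:R
       + 2 / 3 * (ncomp 5 (delete X))%:R + 1 / 3 * (ncomp 7 (delete X))%:R
     <= 2 / 3 * #|X|%:R :> rat) ->
  has_factor (fun H => H = path_graph 2 \/ H = path_graph 9) G.
Proof.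
move=> hyp; apply/tiled_has_factor/tiled_of_weight => X.
apply: leq_trans (weight_ncomp X) _.
rewrite -(ler_nat rat) 3!natrD !natrM; have := hyp X.
by lra.
Qed.
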